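(* Let $R'\le R$ be real numbers with $E(e^{2R'X_1})<\infty$ and $E(e^{2RX_1})<\infty$, let $\Pi$ be a finite complex measure on the strip $\{z\in\mathbb{C}: R'\le \Re(z)\le R\}$, and let $H=f(S_N)$ be square-integrable, where $f:(0,\infty)\to\mathbb{R}$ is of the form $f(s)=\int s^z\,\Pi(dz)$. Define $$g(z):=\frac{m(z+1)-m(1)m(z)}{m(2)-m(1)^2},\qquad h(z):=m(z)-(m(1)-1)g(z),\qquad \lambda:=\frac{m(1)-1}{m(2)-2m(1)+1},$$ $$H_n:=\int S_n^z\,h(z)^{N-n}\,\Pi(dz)\quad (n=0,\dots,N),\qquad \xi_n:=\int S_{n-1}^{z-1}\,g(z)\,h(z)^{N-n}\,\Pi(dz)\quad (n=1,\dots,N).$$ Then the variance-optimal initial capital $V_0$ and the variance-optimal hedging strategy $\phi$ for $H$ are given by $$V_0=H_0$$ and the recursive expression $$\phi_n=\xi_n+\frac{\lambda}{S_{n-1}}\bigl(H_{n-1}-V_0-G_{n-1}(\phi)\bigr),\qquad n=1,\dots,N.$$ The optimal hedge $(V_0,\phi)$ is unique up to a null set.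
   Context: Let $N$ be a positive integer, $(\Omega,\mathcal{F},(\mathcal{F}_n)_{n\in\{0,1,\dots,N\}},P)$ a filtered probability space and $X=(X_n)_{n=0,\dots,N}$ a real-valued process with stationary independent increments: $X$ is adapted, $X_0=0$, the increments $\Delta X_n:=X_n-X_{n-1}$ ($n=1,\dots,N$) all have the same distribution, and $\Delta X_n$ is independent of $\mathcal{F}_{n-1}$. The discounted stock price is $S_n=S_0\exp(X_n)$ with a constant $S_0>0$, and $\Delta S_n:=S_n-S_{n-1}$. Assume $E(e^{2X_1})<\infty$. Let $m(z):=E(e^{zX_1})$ for all $z\in\mathbb{C}$ with $E(e^{\Re(z)X_1})<\infty$ (in particular for $0\le\Re(z)\le2$). Assume that $S$ is not deterministic, i.e. $m(2)-m(1)^2\ne0$. For $s>0$, $z\in\mathbb{C}$ we put $s^z=e^{z\log s}$; moreover $0^0=1$. A process $\theta=(\theta_n)_{n=1,\dots,N}$ is predictable if $\theta_n$ is $\mathcal{F}_{n-1}$-measurable for each $n$. The set $\Theta$ of admissible strategies consists of all real-valued predictable $\theta$ such that $G_n(\theta):=\sum_{k=1}^n\theta_k\Delta S_k$ is square-integrable for $n=1,\dots,N$ (with $G_0(\theta)=0$). A strategy $\phi\in\Theta$ is called a variance-optimal hedging strategy and $V_0\in\mathbb{R}$ a variance-optimal initial capital for $H$ if $c=V_0$ and $\theta=\phi$ minimize $E\bigl((c+G_N(\theta)-H)^2\bigr)$ over all $c\in\mathbb{R}$ and all $\theta\in\Theta$. *)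

(* Defs.v *)
From HB Require Import structures.
From mathcomp Require Import all_boot all_order all_algebra.
From mathcomp Require Import complex.
From mathcomp Require Import all_classical all_reals all_analysis.

Set Implicit Arguments.
Unset Strict Implicit.
Unset Printing Implicit Defensive.

Import Order.TTheory GRing.Theory Num.Theory.
Import numFieldNormedType.Exports.

Local Open Scope classical_set_scope.
Local Open Scope ring_scope.
Local Open Scope complex_scope.

Section complex_borel.
Variable R : realType.

(* The Borel sets of the complex plane, identified with R * R. *)
Definition complex_pair (z : R[i]) : measurableTypeR R * measurableTypeR R :=
  (complex.Re z, complex.Im z).

Definition complex_measurable : set (set R[i]) :=
  preimage_set_system setT complex_pair measurable.

Fact complex_display : measure_display. Proof. exact: default_measure_display. Qed.

Let complex_sigma : sigma_algebra setT complex_measurable.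
Proof. exact/sigma_algebra_preimage/sigma_algebra_measurable. Qed.

Let complex_measurable0 : complex_measurable set0.
Proof. by have [] := complex_sigma. Qed.

Let complex_measurableC A : complex_measurable A -> complex_measurable (~` A).
Proof. by have [_ + _] := complex_sigma => h /h; rewrite setTD. Qed.

Let complex_measurable_bigcup (F : (set R[i])^nat) :
  (forall i, complex_measurable (F i)) -> complex_measurable (\bigcup_i F i).
Proof. by move=> mF; have [_ _] := complex_sigma; exact. Qed.

HB.instance Definition _ := isPointed.Build R[i] 0.
HB.instance Definition _ := @isMeasurable.Build complex_display R[i]
  complex_measurable complex_measurable0 complex_measurableC
  complex_measurable_bigcup.

End complex_borel.

(* A finite complex measure is a charge with values in \bar R[i]: a charge is
   fin_num on measurable sets, and countably additive for the topology of R[i].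
   Its real and imaginary parts are signed measures. *)
Section charge_parts.
Context d (T : measurableType d) (R : realType).
Variable nu : {charge set T -> \bar R[i]}.

Let part (phi : R[i] -> R) (A : set T) : \bar R := (phi (fine (nu A)))%:E.

Let part_sigma_additive (phi : R[i] -> R) :
  phi 0 = 0 -> {morph phi : x y / x + y} -> {morph phi : x / - x} ->
  (forall x, `|phi x|%:C <= `|x|) -> semi_sigma_additive (part phi).
Proof.
move=> phi0 phiD phiN phi_le F mF tF mUF.
pose psi (x : \bar R[i]) : \bar R := (phi (fine x))%:E.
have -> : (fun n => \sum_(0 <= i < n) part phi (F i))%E =
          psi \o (fun n => \sum_(0 <= i < n) nu (F i))%E.
  apply/funext => n /=.
  have -> : (\sum_(0 <= i < n) nu (F i) =
             (\sum_(0 <= i < n) fine (nu (F i)))%:E)%E.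
    by rewrite -sumEFin; apply: eq_bigr => i _; rewrite fineK ?fin_num_measure.
  rewrite /psi /part sumEFin /=; congr EFin.
  by rewrite (big_morph phi phiD phi0).
have nuF := @charge_semi_sigma_additive _ _ _ nu F mF tF mUF.
apply: (cvg_comp _ _ nuF); rewrite /part.
rewrite -[nu _](fineK (fin_num_measure nu _ mUF)) /=.
move: (fine _) => l A nA.
have {nA}: nbhs (phi l) (fun r => A r%:E) by [].
move=> /nbhs_ballP[e /= e0 eA].
change (nbhs l (fun z => A (psi z%:E))).
apply/nbhs_ballP; exists e%:C => /=; first by rewrite ltcE /= eqxx.
move=> z; rewrite /ball /= => lz; apply: eA; rewrite /ball /=.
by rewrite -ltcR -phiN -phiD (le_lt_trans (phi_le _)).
Qed.

Definition re_charge (A : set T) : \bar R := (complex.Re (fine (nu A)))%:E.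
Definition im_charge (A : set T) : \bar R := (complex.Im (fine (nu A)))%:E.

Let re_charge0 : re_charge set0 = 0%E.
Proof. by rewrite /re_charge charge0. Qed.

Let re_charge_fin A : measurable A -> re_charge A \is a fin_num.
Proof. by []. Qed.

Let re_charge_sigma_additive : semi_sigma_additive re_charge.
Proof.
apply: (@part_sigma_additive (@complex.Re R)) => //;
  [by case=> ? ? [] | by case | ].
exact: normc_ge_Re.
Qed.

HB.instance Definition _ := isCharge.Build d T R re_charge
  re_charge0 re_charge_fin re_charge_sigma_additive.

Let im_charge0 : im_charge set0 = 0%E.
Proof. by rewrite /im_charge charge0. Qed.

Let im_charge_fin A : measurable A -> im_charge A \is a fin_num.
Proof. by []. Qed.

Let im_charge_sigma_additive : semi_sigma_additive im_charge.
Proof.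
apply: (@part_sigma_additive (@complex.Im R)) => //;
  [by case=> ? ? [] | by case | ].
case=> a b; rewrite normc_def lecR /= -sqrtr_sqr ler_wsqrtr//.
by rewrite lerDr sqr_ge0.
Qed.

HB.instance Definition _ := isCharge.Build d T R im_charge
  im_charge0 im_charge_fin im_charge_sigma_additive.

End charge_parts.

Section complex_integral.
Variable R : realType.

(* Total choice of a Hahn decomposition; the integral below does not depend on
   it by Hahn_decomposition_uniq. *)
Definition hahn_pos d (T : measurableType d) (nu : {charge set T -> \bar R}) :
  set T := sval (cid (Hahn_decomposition nu)).

Definition hahn_neg d (T : measurableType d) (nu : {charge set T -> \bar R}) :
  set T := sval (cid (svalP (cid (Hahn_decomposition nu)))).

Lemma hahn_posneg d (T : measurableType d) (nu : {charge set T -> \bar R}) :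
  hahn_decomposition nu (hahn_pos nu) (hahn_neg nu).
Proof. exact: svalP (cid (svalP (cid (Hahn_decomposition nu)))). Qed.

Definition charge_integral d (T : measurableType d)
    (nu : {charge set T -> \bar R}) (D : set T) (u : T -> R) : R :=
  \int[jordan_pos (hahn_posneg nu)]_(x in D) u x -
  \int[jordan_neg (hahn_posneg nu)]_(x in D) u x.

(* nu = Re nu + i Im nu and u = Re u + i Im u, expanded by bilinearity. *)
Definition complex_charge_integral d (T : measurableType d)
    (nu : {charge set T -> \bar R[i]}) (D : set T) (u : T -> R[i]) : R[i] :=
  let a := re_charge nu in
  let b := im_charge nu in
  let ur := fun x => complex.Re (u x) in
  let ui := fun x => complex.Im (u x) in
  (charge_integral a D ur - charge_integral b D ui) +i*
  (charge_integral a D ui + charge_integral b D ur).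

Definition complex_expectation d (T : measurableType d) (P : probability T R)
    (Z : T -> R[i]) : R[i] :=
  (\int[P]_w complex.Re (Z w)) +i* (\int[P]_w complex.Im (Z w)).

Definition cexp (z : R[i]) : R[i] :=
  (expR (complex.Re z))%:C *
  (cos (complex.Im z) +i* sin (complex.Im z)).

Definition cpow (s : R) (z : R[i]) : R[i] := cexp (z * (ln s)%:C).

Definition strip (a b : R) : set R[i] :=
  [set z | a <= complex.Re z /\ complex.Re z <= b].

Definition concentrated_on d (T : measurableType d)
    (nu : {charge set T -> \bar R[i]}) (D : set T) :=
  forall A, measurable A -> A `&` D = set0 -> nu A = 0%E.

End complex_integral.

Section market.
Context (R : realType) d (T : measurableType d) (P : probability T R).
Implicit Types (N n : nat) (F : nat -> set (set T)) (X S theta : nat -> T -> R).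

Definition filtration N F :=
  [/\ forall n, (n <= N)%N -> sigma_algebra setT (F n),
      forall n, (n <= N)%N -> F n `<=` measurable &
      forall m n, (m <= n)%N -> (n <= N)%N -> F m `<=` F n].

Definition measurable_wrt (G : set (set T)) (Y : T -> R) :=
  measurable_fun setT (Y : g_sigma_algebraType G -> R).

Definition independent_of (Y : T -> R) (G : set (set T)) :=
  forall A B, G A -> measurable B ->
    P (A `&` Y @^-1` B) = (P A * P (Y @^-1` B))%E.

Definition incr X n (w : T) : R := X n w - X n.-1 w.

Definition stationary_independent_increments N F X :=
  [/\ forall n, (n <= N)%N -> measurable_wrt (F n) (X n),
      forall w, X 0%N w = 0,
      forall m n, (0 < m <= N)%N -> (0 < n <= N)%N -> forall B, measurable B ->
        pushforward P (incr X m) B = pushforward P (incr X n) B &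
      forall n, (0 < n <= N)%N -> independent_of (incr X n) (F n.-1)].

Definition price (S0 : R) X n (w : T) : R := S0 * expR (X n w).

Definition predictable N F theta :=
  forall n, (0 < n <= N)%N -> measurable_wrt (F n.-1) (theta n).

Definition gain S theta n (w : T) : R :=
  \sum_(1 <= k < n.+1) theta k w * incr S k w.

Definition admissible N F S theta :=
  predictable N F theta /\
  forall n, (0 < n <= N)%N -> gain S theta n \in Lfun P 2%:E.

Definition quadratic_error N S (H : T -> R) (c : R) theta : \bar R :=
  'E_P[fun w => ((c + gain S theta N w - H w) ^+ 2)%R]%E.

Definition variance_optimal N F S (H : T -> R) (V0 : R) phi :=
  admissible N F S phi /\
  forall c theta, admissible N F S theta ->
    (quadratic_error N S H V0 phi <= quadratic_error N S H c theta)%E.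

(* Meaningful when E(exp(Re z * Y)) < +oo; a junk value otherwise. *)
Definition mgf (Y : T -> R) (z : R[i]) : R[i] :=
  complex_expectation P (fun w => cexp (z * (Y w)%:C)).

End market.

Section hedge_coefficients.
Variables (R : realType) (m : R[i] -> R[i]).

Definition hedge_g (z : R[i]) : R[i] :=
  (m (z + 1) - m 1 * m z) / (m 2 - m 1 ^+ 2).

Definition hedge_h (z : R[i]) : R[i] := m z - (m 1 - 1) * hedge_g z.

Definition hedge_lambda : R[i] := (m 1 - 1) / (m 2 - 2 * m 1 + 1).

Variables (nu : {charge set R[i] -> \bar R[i]}) (D : set R[i]) (N : nat).

(* Hn and xin as functions of the current price s = S_n, resp. s = S_{n-1}. *)
Definition hedge_H (n : nat) (s : R) : R[i] :=
  complex_charge_integral nu D (fun z => cpow s z * hedge_h z ^+ (N - n)).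

Definition hedge_xi (n : nat) (s : R) : R[i] :=
  complex_charge_integral nu D
    (fun z => cpow s (z - 1) * hedge_g z * hedge_h z ^+ (N - n)).

End hedge_coefficients.

(* Main.v *)
Require Import Defs.
From HB Require Import structures.
From mathcomp Require Import all_boot all_order all_algebra.
From mathcomp Require Import complex.
From mathcomp Require Import all_classical all_reals all_analysis.
From mathcomp Require Import measurable_realfun.
From mathcomp Require Import zify ring lra.

Set Implicit Arguments.
Unset Strict Implicit.
Unset Printing Implicit Defensive.

Import Order.TTheory GRing.Theory Num.Theory.
Import numFieldNormedType.Exports.

Local Open Scope classical_set_scope.
Local Open Scope ring_scope.
Local Open Scope complex_scope.

(** The problem is solved by backward least squares.  Given the past, one period
    of hedging with position [t] and current balance [p] (capital plus gains)
    leaves the error [u - p - t * Y], where [u] is the value of the claim at the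
    end of the period and [Y] the return of the stock, whose mean is [a] and
    whose mean square is [b].  Completing the square, [regression_error], gives
    its mean square as

      [b * (t - slope - a / b * (icpt - p)) ^+ 2
       + (b - a ^+ 2) / b * (icpt - p) ^+ 2 + resid]

    with the coefficients of the regression of [u] on [Y].  Take the intercept
    as the value at the beginning of the period.  As the increments are
    independent and all have the law [mu], Tonelli's theorem, in the form
    [ge0_integral_indep], integrates this identity to a recursion in [0, +oo]
    for the mean square error of an arbitrary predictable strategy,
    [hedge_error_step]:

      [err n = b * E (deviation n) ^+ 2 + (b - a ^+ 2) / b * err n.-1 + E resid n].

    Since [b - a ^+ 2], the variance of the return, is positive, the final error
    is smallest exactly when the initial error and all deviations vanish, that
    is, when the initial capital is the initial value and each position is the
    slope plus [a / b] times the current shortfall.  This yields optimality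
    and uniqueness.  Applied to the strategy that never trades, the same
    recursion bounds the value process in mean square by the payoff, whence the
    optimal strategy is admissible.

    It remains to identify values and slopes with the integrals over the strip.
    Slope and intercept are the means of [u] against two real weights,
    [hedge_weight] and [value_weight], whose moments
    [E (exp (z X) * weight X)] are [g z] and [h z] ([hedge_gE] and [hedge_hE]).
    By Fubini's theorem, [strip_integral_moment], multiplying the integrand [s `^ z] by
    such a moment is the same as averaging the function over the next price
    with that weight.  So each step back in time brings one factor [h], the slope
    brings one factor [g], and all integrals are real because the claim and the
    weights are ([strip_integral_q_real]). *)

(** * Square-integrable functions *)

Section square_integrable.
Context (R : realType) d (T : measurableType d).

Lemma integrable_mull (mu : {measure set T -> \bar R}) (c : R) (f : T -> R) :
  mu.-integrable setT (EFin \o f) ->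
  mu.-integrable setT (EFin \o (fun x => c * f x)).
Proof.
by move=> fi; have := integrableZl measurableT c fi; apply: eq_integrable.
Qed.

Lemma integrable_add (mu : {measure set T -> \bar R}) (f g : T -> R) :
  mu.-integrable setT (EFin \o f) -> mu.-integrable setT (EFin \o g) ->
  mu.-integrable setT (EFin \o (fun x => f x + g x)).
Proof.
by move=> fi gi; have := integrableD measurableT fi gi; apply: eq_integrable.
Qed.

(** The extended integral of the square is the quantity that the hedging
    recursion controls. *)
Lemma Lfun2P (mu : {measure set T -> \bar R}) (Z : T -> R) :
  Z \in Lfun mu 2%:E <->
  measurable_fun setT Z /\ (\int[mu]_w (Z w ^+ 2)%:E < +oo)%E.
Proof.
split=> [Z2|[mZ Z2]].
  split; first by move: Z2; rewrite inE => /andP[/[!inE]].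
  have /integrableP[_] := Lfun2_integrable_sqr Z2.
  by under eq_integral do rewrite /= ger0_norm ?sqr_ge0//.
rewrite inE; apply/andP; split; rewrite inE//=.
rewrite /finite_norm unlock /= poweR_lty//.
rewrite (_ : integral _ _ _ = \int[mu]_w (Z w ^+ 2)%:E)%E//.
apply: eq_integral => w _.
by rewrite powR_mulrn// -normrX ger0_norm ?sqr_ge0.
Qed.

Lemma Lfun2D (mu : {measure set T -> \bar R}) (f g : T -> R) :
  f \in Lfun mu 2%:E -> g \in Lfun mu 2%:E ->
  (fun x => f x + g x) \in Lfun mu 2%:E.
Proof. by move=> hf hg; rewrite -[X in X \in _]/(f + g) rpredD ?lee1n. Qed.

Lemma Lfun2B (mu : {measure set T -> \bar R}) (f g : T -> R) :
  f \in Lfun mu 2%:E -> g \in Lfun mu 2%:E ->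
  (fun x => f x - g x) \in Lfun mu 2%:E.
Proof. by move=> hf hg; rewrite -[X in X \in _]/(f - g) rpredB ?lee1n. Qed.

Lemma Lfun2Z (mu : {measure set T -> \bar R}) (f : T -> R) c :
  f \in Lfun mu 2%:E -> (fun x => c * f x) \in Lfun mu 2%:E.
Proof.
move=> hf; rewrite (_ : (fun _ => _) = c \o* f).
  by apply: Lfun_scale => //; rewrite ler1n.
by apply/funext => x /=; rewrite mulrC.
Qed.

Lemma Lfun2_le (mu : {measure set T -> \bar R}) (u v : T -> R) :
  measurable_fun setT u -> v \in Lfun mu 2%:E ->
  (forall y, `|u y| <= v y) -> u \in Lfun mu 2%:E.
Proof.
move=> mu_ /Lfun2P[mv v2] uv; apply/Lfun2P; split=> //.
apply: le_lt_trans v2; apply: ge0_le_integral => //.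
- by move=> y _; rewrite lee_fin sqr_ge0.
- by apply/measurable_EFinP; exact: measurable_funX.
- by apply/measurable_EFinP; exact: measurable_funX.
move=> y _; rewrite lee_fin -real_normK ?num_real//.
by rewrite lerXn2r// nnegrE// (le_trans _ (uv y)).
Qed.

Lemma Lfun2_mul (mu : {measure set T -> \bar R}) (u v : T -> R) :
  u \in Lfun mu 2%:E -> v \in Lfun mu 2%:E ->
  mu.-integrable setT (EFin \o (fun x => u x * v x)).
Proof. by move=> hu hv; apply/Lfun1_integrable; exact: Lfun2_mul_Lfun1. Qed.

Lemma Lfun2_int (mu : {finite_measure set T -> \bar R}) (u : T -> R) :
  u \in Lfun mu 2%:E -> mu.-integrable setT (EFin \o u).
Proof.
move=> hu; apply/Lfun1_integrable; apply: Lfun_subset12 => //.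
exact: fin_num_measure.
Qed.

End square_integrable.

(** * Integrating out an independent increment *)

(** Tonelli's theorem for a variable [Y] that is independent of [G].  The
    left argument of [u] ranges over the probability space carrying the smaller
    sigma-algebra [G]: then [w |-> (w, Y w)] sends [P] to the product of
    [P] restricted to [G] with the law [mu], so that [u] may involve any
    [G]-measurable strategy. *)
Lemma ge0_integral_indep (R : realType) (d : measure_display)
    (T : measurableType d) (P : probability T R) (G : set (set T))
    (d' : measure_display) (E : measurableType d')
    (Y : T -> E) (mu : probability E R)
    (u : g_sigma_algebraType G * E -> \bar R) :
  sigma_algebra setT G -> G `<=` measurable -> measurable_fun setT Y ->
  (forall A B, G A -> measurable B ->
    P (A `&` Y @^-1` B) = (P A * mu B)%E) ->
  measurable_fun setT u -> (forall x, 0 <= u x)%E ->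
  (\int[P]_w u (w, Y w) = \int[P]_w \int[mu]_y u (w, y))%E.
Proof.
move=> sG GM mY indep mu_ u0.
have GE : <<s G>> = G by exact: sigma_algebra_id.
pose idG : T -> g_sigma_algebraType G := fun w => w.
have midG : measurable_fun setT idG.
  by move=> _ A; rewrite /measurable /= GE setTI => /GM.
pose idGY : T -> g_sigma_algebraType G * E := fun w => (idG w, Y w).
have midGY : measurable_fun setT idGY by exact: measurable_fun_pair.
pose idGm : {mfun T >-> g_sigma_algebraType G} :=
  HB.pack idG (isMeasurableFun.Build _ _ _ _ _ midG).
pose idGYm : {mfun T >-> (g_sigma_algebraType G * E)%type} :=
  HB.pack idGY (isMeasurableFun.Build _ _ _ _ _ midGY).
pose PG : probability (g_sigma_algebraType G) R := distribution P idGm.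
have PE A : measurable A -> (PG \x mu)%E A = pushforward P idGYm A.
  apply: product_measure_unique => A1 B mA mB.
  have GA : G A1 by move: mA; rewrite /measurable /= GE.
  by rewrite /pushforward /= -(indep _ _ GA mB).
transitivity (\int[pushforward P idGYm]_z u z)%E.
  by rewrite ge0_integral_pushforward.
rewrite -(eq_measure_integral (pushforward P idGYm) (m1 := (PG \x mu)%E)); last first.
  by move=> A mA _; exact: PE.
rewrite fubini_tonelli1//= /PG /distribution ge0_integral_pushforward//.
  exact: measurable_fun_fubini_tonelli_F.
by move=> y _; exact: integral_ge0.
Qed.

(** * Least-squares regression of one variable on another *)

Section least_squares.
Context (R : realType) (d : measure_display) (E : measurableType d).
Variable mu : probability E R.
Implicit Types u v : E -> R.

Definition mean u : R := \int[mu]_x u x.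
Definition regr_slope u v : R :=
  (mean (fun x => u x * v x) - mean u * mean v) /
  (mean (fun x => v x ^+ 2) - mean v ^+ 2).
Definition regr_icpt u v : R := mean u - mean v * regr_slope u v.
Definition regr_resid u v : R :=
  mean (fun x => (u x - regr_icpt u v - regr_slope u v * v x) ^+ 2).

Lemma mean_expand u v (p t : R) : u \in Lfun mu 2%:E -> v \in Lfun mu 2%:E ->
  mu.-integrable setT (EFin \o (fun x => (u x - p - t * v x) ^+ 2)) /\
  mean (fun x => (u x - p - t * v x) ^+ 2) =
  mean (fun x => u x ^+ 2) + p ^+ 2 + t ^+ 2 * mean (fun x => v x ^+ 2)
  - 2 * p * mean u - 2 * t * mean (fun x => u x * v x) + 2 * p * t * mean v.
Proof.
move=> hu hv.
have iu := Lfun2_int hu; have iv := Lfun2_int hv.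
have iuu := Lfun2_integrable_sqr hu; have ivv := Lfun2_integrable_sqr hv.
have iuv := Lfun2_mul hu hv.
have ic c : mu.-integrable setT (EFin \o (fun _ : E => c : R)).
  by apply: finite_measure_integrable_cst.
have eqf : (fun x => (u x - p - t * v x) ^+ 2) =
   (fun x => u x ^+ 2 + (p ^+ 2 + (t ^+ 2 * v x ^+ 2 +
      ((- (2 * p)) * u x + ((- (2 * t)) * (u x * v x) + (2 * p * t) * v x))))).
  by apply/funext => x; ring.
have i5 := integrable_add (integrable_mull (- (2 * t)) iuv)
  (integrable_mull (2 * p * t) iv).
have i4 := integrable_add (integrable_mull (- (2 * p)) iu) i5.
have i3 := integrable_add (integrable_mull (t ^+ 2) ivv) i4.
have i2 := integrable_add (ic (p ^+ 2)) i3.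
rewrite eqf; split; first exact: integrable_add.
rewrite /mean RintegralD// RintegralD// RintegralD//; last exact: integrable_mull.
rewrite RintegralD//; last exact: integrable_mull.
rewrite RintegralD//; [|exact: integrable_mull..].
rewrite !RintegralZl// Rintegral_cst//.
have -> : fine (mu setT) = 1 by rewrite probability_setT.
ring.
Qed.

(** Completing the square.  For a fixed intercept [p] the quadratic in the
    position [t] has its minimum at
    [regr_slope + a / b * (regr_icpt - p)], which is where the hedging rule
    and its feedback coefficient [a / b] come from; for this [t] a mismatch
    [regr_icpt - p] is damped by the factor [(b - a ^+ 2) / b]. *)
Lemma regression_error u v (p t : R) (a := mean v)
    (b := mean (fun x => v x ^+ 2)) :
  u \in Lfun mu 2%:E -> v \in Lfun mu 2%:E -> 0 < b - a ^+ 2 ->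
  (\int[mu]_x ((u x - p - t * v x) ^+ 2)%:E =
   (b * (t - regr_slope u v - a / b * (regr_icpt u v - p)) ^+ 2
    + (b - a ^+ 2) / b * (regr_icpt u v - p) ^+ 2 + regr_resid u v)%:E)%E.
Proof.
move=> hu hv var_gt0.
have [i1 e1] := mean_expand p t hu hv.
rewrite -[LHS]fineK; last exact: integrable_fin_num.
rewrite -/(Rintegral mu setT _) -/(mean _) e1; congr EFin.
rewrite /regr_resid; have [_ ->] := mean_expand (regr_icpt u v)
  (regr_slope u v) hu hv.
rewrite /regr_icpt /regr_slope -/a -/b.
have a2 : 0 <= a ^+ 2 by exact: sqr_ge0.
have b0 : b != 0 by rewrite gt_eqF//; lra.
have v0 : b - a ^+ 2 != 0 by rewrite gt_eqF.
by field; rewrite v0 b0.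
Qed.

End least_squares.

(** The cancellation behind uniqueness: it reads equality in the error
    recursion backwards, in a form valid for extended reals. *)
Lemma ereal_squeeze (R : realType) (r s : R) (A E' E L : \bar R) :
  0 < r -> 0 < s -> (0 <= A)%E -> (0 <= E')%E -> (E <= E')%E ->
  E \is a fin_num -> L \is a fin_num ->
  (r%:E * A + s%:E * E' + L <= s%:E * E + L)%E -> A = 0%E /\ (E' <= E)%E.
Proof.
move=> r0 s0.
case: A => [A| |]; case: E' => [E'| |]; case: E => [E| |]; case: L => [L| |] //=;
  rewrite ?gt0_muley ?lte_fin//=.
- rewrite -!EFinM -!EFinD !lee_fin => A0 E'0 EE' _ _ h.
  have h1 : r * A + s * E' <= s * E by lra.
  have rA : 0 <= r * A by rewrite mulr_ge0// ltW.
  have sE : s * E <= s * E' by rewrite ler_pM2l.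
  split; last by rewrite -(ler_pM2l s0); lra.
  congr EFin; apply/eqP; rewrite eq_le A0 andbT -(ler_pM2l r0) mulr0; lra.
all: by rewrite ?gt0_muley ?lte_fin.
Qed.

(** * The hedging error of a Markovian claim *)

Section error.
Context (R : realType) d (T : measurableType d) (P : probability T R).
Variables (N : nat) (F : nat -> set (set T)) (X : nat -> T -> R) (S0 : R).
Hypothesis F_filtration : filtration N F.
Hypothesis S0_gt0 : 0 < S0.
Hypothesis X_adapted : forall n, (n <= N)%N -> measurable_wrt (F n) (X n).
Hypothesis X0 : forall w, X 0%N w = 0.
Variable mu : probability R R.
Hypothesis X_indep : forall n, (0 < n <= N)%N -> forall A B, F n.-1 A ->
  measurable B -> (P (A `&` incr X n @^-1` B) = P A * mu B)%E.

(** The return of the stock over one period as a function of the increment of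
    the log-price: [incr S n = S n.-1 * yield (incr X n)]. *)
Definition yield (y : R) : R := expR y - 1.

Local Notation a := (mean mu yield).
Local Notation b := (mean mu (fun y => yield y ^+ 2)).
Hypothesis yield_L2 : yield \in Lfun mu 2%:E.
Hypothesis var_gt0 : 0 < b - a ^+ 2.

Variable k : nat -> R -> R.
Local Notation chi n x := (regr_slope mu (fun y => k n (x + y)) yield).
Hypothesis k_meas : forall n, (n <= N)%N -> measurable_fun setT (k n).
Hypothesis k_L2 : forall n x, (n <= N)%N -> (fun y => k n (x + y)) \in Lfun mu 2%:E.
Hypothesis k_rec : forall n x, (0 < n <= N)%N ->
  k n.-1 x = regr_icpt mu (fun y => k n (x + y)) yield.
Hypothesis chi_meas : forall n, (0 < n <= N)%N -> measurable_fun setT (fun x : R => chi n x).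

Local Notation S := (price S0 X).

(** [k n (X n)] plays the part of the value process.  [hedge_dev] measures by how
    much the amount invested at time [n] differs from the minimiser found in
    [regression_error]. *)
Definition hedge_error n c theta w : R := k n (X n w) - c - gain S theta n w.
Definition hedge_dev n c theta w : R :=
  theta n w * S n.-1 w - chi n (X n.-1 w) - a / b * hedge_error n.-1 c theta w.
Definition resid n w : R :=
  regr_resid mu (fun y => k n (X n.-1 w + y)) yield.
Definition sq_norm (Z : T -> R) : \bar R := (\int[P]_w ((Z w) ^+ 2)%:E)%E.

Lemma measurable_wrt_mono m n (Y : T -> R) : (m <= n)%N -> (n <= N)%N ->
  measurable_wrt (F m) Y -> measurable_wrt (F n) Y.
Proof.
move=> mn nN mY _ A mA.
have [sF _ Fmono] := F_filtration.
have := mY measurableT A mA; rewrite /measurable /=.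
by rewrite !sigma_algebra_id; [exact: Fmono|exact: sF|exact/sF/(leq_trans mn)].
Qed.

Lemma measurable_wrtT n (Y : T -> R) : (n <= N)%N -> measurable_wrt (F n) Y ->
  measurable_fun setT Y.
Proof.
move=> nN mY _ A mA.
have [sF FM _] := F_filtration.
have := mY measurableT A mA; rewrite {1}/measurable /= sigma_algebra_id; last exact: sF.
exact: FM.
Qed.

Lemma price_gt0 n w : 0 < S n w.
Proof. by rewrite mulr_gt0// expR_gt0. Qed.

Lemma measurable_price n : (n <= N)%N -> measurable_wrt (F n) (S n).
Proof.
move=> nN; apply: measurable_funM => //.
by apply: measurableT_comp => //; exact: X_adapted.
Qed.

Lemma gain0 (theta : nat -> T -> R) w : gain S theta 0 w = 0.
Proof. by rewrite /gain big_geq. Qed.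

Lemma gainS (theta : nat -> T -> R) n w : (0 < n)%N ->
  gain S theta n w = gain S theta n.-1 w + theta n w * incr S n w.
Proof. by case: n => // n _; rewrite /gain big_nat_recr. Qed.

Lemma measurable_gain (theta : nat -> T -> R) n : (n <= N)%N -> predictable N F theta ->
  measurable_wrt (F n) (gain S theta n).
Proof.
move=> + ptheta; elim: n => [|n IH] nN.
  rewrite /measurable_wrt (_ : gain _ _ _ = cst 0) ?funeqE//.
  by move=> w; rewrite gain0.
rewrite /measurable_wrt (_ : gain _ _ _ = fun w => gain S theta n w +
   theta n.+1 w * (S n.+1 w - S n w)); last first.
  by apply/funext => w; rewrite gainS.
apply: measurable_funD; first exact: (measurable_wrt_mono (m := n)) (IH (ltnW nN)).
apply: measurable_funM.
  have /= p := ptheta n.+1; apply: (measurable_wrt_mono (m := n)) => //.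
  exact: p.
apply: measurable_funB; first exact: measurable_price.
by apply: (measurable_wrt_mono (m := n)) => //; apply: measurable_price; exact: ltnW.
Qed.

Lemma measurable_error n c theta : (n <= N)%N -> predictable N F theta ->
  measurable_wrt (F n) (hedge_error n c theta).
Proof.
move=> nN ptheta; apply: measurable_funB; last exact: measurable_gain.
apply: measurable_funB => //.
by apply: measurableT_comp; [exact: k_meas|exact: X_adapted].
Qed.

Lemma measurable_dev n c theta : (0 < n <= N)%N -> predictable N F theta ->
  measurable_wrt (F n.-1) (hedge_dev n c theta).
Proof.
move=> nN ptheta; have n1N : (n.-1 <= N)%N by lia.
apply: measurable_funB.
  apply: measurable_funB.
    by apply: measurable_funM; [exact: ptheta|exact: measurable_price].
  by apply: (measurableT_comp (chi_meas nN)); exact: X_adapted.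
by apply: measurable_funM => //; exact: measurable_error.
Qed.

Lemma measurable_yield : measurable_fun setT yield.
Proof. by apply: measurable_funB => //; exact: measurable_expR. Qed.

Lemma measurable_regr_resid n : (0 < n <= N)%N ->
  measurable_fun setT (fun x : R => regr_resid mu (fun y => k n (x + y)) yield).
Proof.
move=> nN; have n1N : (n.-1 <= N)%N by lia.
have nN' : (n <= N)%N by lia.
pose f (z : R * R) : \bar R := ((k n (z.1 + z.2) - k n.-1 z.1
  - chi n z.1 * yield z.2) ^+ 2)%:E.
have mf : measurable_fun setT f.
  apply/measurable_EFinP; apply: measurable_funX.
  apply: measurable_funB; first apply: measurable_funB.
  - by apply: measurableT_comp; [exact: k_meas|exact: measurable_funD].
  - by apply: measurableT_comp; [exact: k_meas|].
  - apply: measurable_funM.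
      by apply: (measurableT_comp (chi_meas nN)).
    by apply: (measurableT_comp measurable_yield).
have mF := measurable_fun_fubini_tonelli_F (m2 := mu) f mf.
rewrite (_ : (fun _ => _) = fine \o fubini_F mu f).
  by apply: measurableT_comp => //; apply: mF => x; rewrite lee_fin sqr_ge0.
apply/funext => x; rewrite /= /fubini_F /f /regr_resid /mean /Rintegral.
by rewrite /= k_rec.
Qed.

Lemma incr_price n w : incr S n w = S n.-1 w * yield (incr X n w).
Proof.
rewrite /incr /price /yield expRD expRN.
by field; rewrite gt_eqF ?expR_gt0.
Qed.

Lemma incr_split n w : X n w = X n.-1 w + incr X n w.
Proof. by rewrite /incr addrC subrK. Qed.

Lemma sq_norm_ge0 Z : (0 <= sq_norm Z)%E.
Proof. by apply: integral_ge0 => w _; rewrite lee_fin sqr_ge0. Qed.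

Lemma b_gt0 : 0 < b.
Proof. by apply: (lt_le_trans var_gt0); rewrite lerBlDr lerDl sqr_ge0. Qed.

Lemma resid_ge0 n w : 0 <= resid n w.
Proof. by apply: Rintegral_ge0 => y _; exact: sqr_ge0. Qed.

(** Given the past, the error at time [n] is the regression error of the claim
    value on the return, with intercept [c + gain] and position
    [theta n * S n.-1].  All terms are nonnegative, hence the identity holds
    in [0, +oo] for every predictable strategy, admissible or not. *)
Lemma hedge_error_step n c theta : (0 < n <= N)%N -> predictable N F theta ->
  (sq_norm (hedge_error n c theta) =
   b%:E * sq_norm (hedge_dev n c theta) +
   ((b - a ^+ 2) / b)%:E * sq_norm (hedge_error n.-1 c theta) +
   \int[P]_w (resid n w)%:E)%E.
Proof.
move=> nN ptheta; have n1N : (n.-1 <= N)%N by lia.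
have nN' : (n <= N)%N by lia.
have n_gt0 : (0 < n)%N by lia.
have [sF FM _] := F_filtration.
pose u (z : g_sigma_algebraType (F n.-1) * R) : \bar R :=
  ((k n (X n.-1 z.1 + z.2) - (c + gain S theta n.-1 z.1)
    - (theta n z.1 * S n.-1 z.1) * yield z.2) ^+ 2)%:E.
have mu_ : measurable_fun setT u.
  apply/measurable_EFinP; apply: measurable_funX.
  apply: measurable_funB; first apply: measurable_funB.
  - apply: measurableT_comp; first exact: k_meas.
    apply: measurable_funD => //.
    by apply: measurableT_comp; [exact: X_adapted|].
  - apply: measurable_funD => //.
    by apply: measurableT_comp; [exact: measurable_gain|].
  - apply: measurable_funM; last by apply: (measurableT_comp measurable_yield).
    apply: measurable_funM.
      by apply: (measurableT_comp (ptheta _ nN)).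
    by apply: measurableT_comp; [exact: measurable_price|].
have mincr : measurable_fun setT (incr X n).
  apply: measurable_funB; first by apply: (measurable_wrtT nN'); exact: X_adapted.
  by apply: (measurable_wrtT n1N); exact: X_adapted.
transitivity (\int[P]_w u (w, incr X n w))%E.
  apply: eq_integral => w _; rewrite /u /= -incr_split /hedge_error.
  by rewrite gainS// incr_price; congr (_ ^+ 2)%:E; ring.
rewrite (ge0_integral_indep (sF _ n1N) (FM _ n1N) mincr (X_indep nN) mu_); last first.
  by move=> z; rewrite lee_fin sqr_ge0.
have ux w : (\int[mu]_y u (w, y) = (b * hedge_dev n c theta w ^+ 2)%:E +
    ((b - a ^+ 2) / b * hedge_error n.-1 c theta w ^+ 2)%:E + (resid n w)%:E)%E.
  rewrite /u /= regression_error//; last exact: k_L2.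
  rewrite -k_rec// -!EFinD /resid /hedge_dev /hedge_error; congr (_ %:E).
  by rewrite opprD addrA.
under eq_integral do rewrite ux.
have b0 := b_gt0.
have rho0 : 0 <= (b - a ^+ 2) / b by rewrite divr_ge0// ltW.
have mdev : measurable_fun setT (hedge_dev n c theta).
  by apply: (measurable_wrtT n1N); exact: measurable_dev.
have merr : measurable_fun setT (hedge_error n.-1 c theta).
  by apply: (measurable_wrtT n1N); exact: measurable_error.
have mres : measurable_fun setT (resid n).
  apply: (measurableT_comp (measurable_regr_resid nN)).
  by apply: (measurable_wrtT n1N); exact: X_adapted.
have m1 : measurable_fun setT (fun w => (hedge_dev n c theta w ^+ 2)%:E).
  by apply/measurable_EFinP; exact: measurable_funX.
have m2 : measurable_fun setT (fun w => (hedge_error n.-1 c theta w ^+ 2)%:E).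
  by apply/measurable_EFinP; exact: measurable_funX.
have e1 w : (0 <= (b * hedge_dev n c theta w ^+ 2)%:E)%E.
  by rewrite lee_fin mulr_ge0 ?sqr_ge0// ltW.
have e2 w : (0 <= ((b - a ^+ 2) / b * hedge_error n.-1 c theta w ^+ 2)%:E)%E.
  by rewrite lee_fin mulr_ge0 ?sqr_ge0.
have mZ g r : measurable_fun setT (fun w => (g w)%:E) ->
    measurable_fun setT (fun w : T => (r * g w)%:E : \bar R).
  by move=> /measurable_EFinP mg; apply/measurable_EFinP; exact: measurable_funM.
rewrite ge0_integralD//; last 4 first.
- by move=> w _; exact: adde_ge0.
- by apply: emeasurable_funD; exact: mZ.
- by move=> w _; rewrite lee_fin resid_ge0.
- exact/measurable_EFinP.
rewrite ge0_integralD//; [|exact: mZ|exact: mZ].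
congr (_ + _ + _)%E.
  under eq_integral do rewrite EFinM.
  by rewrite ge0_integralZl_EFin// ?ltW// => w _; rewrite lee_fin sqr_ge0.
under eq_integral do rewrite EFinM.
by rewrite ge0_integralZl_EFin// => w _; rewrite lee_fin sqr_ge0.
Qed.

Lemma sq_norm_ltyP n c theta : (0 < n <= N)%N -> predictable N F theta ->
  (sq_norm (hedge_error n c theta) < +oo)%E ->
  (sq_norm (hedge_error n.-1 c theta) < +oo)%E /\
  (\int[P]_w (resid n w)%:E < +oo)%E.
Proof.
move=> nN ptheta; rewrite hedge_error_step//.
have rho0 : 0 < (b - a ^+ 2) / b by rewrite divr_gt0// b_gt0.
have dge0 := sq_norm_ge0 (hedge_dev n c theta).
have ege0 := sq_norm_ge0 (hedge_error n.-1 c theta).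
have rge0 : (0 <= \int[P]_w (resid n w)%:E)%E.
  by apply: integral_ge0 => w _; rewrite lee_fin resid_ge0.
have bd : (0 <= b%:E * sq_norm (hedge_dev n c theta))%E.
  by rewrite mule_ge0// lee_fin ltW// b_gt0.
have be : (0 <= ((b - a ^+ 2) / b)%:E * sq_norm (hedge_error n.-1 c theta))%E.
  by rewrite mule_ge0// lee_fin ltW.
move=> h; split; last first.
  by apply: le_lt_trans h; rewrite leeDr// adde_ge0.
have {}h : (((b - a ^+ 2) / b)%:E * sq_norm (hedge_error n.-1 c theta) < +oo)%E.
  apply: le_lt_trans h; rewrite -addeA addeC -addeA leeDl// adde_ge0//.
move: ege0 h; case: (sq_norm (hedge_error n.-1 c theta)) => // [r|].
  by move=> *; rewrite ltry.
by rewrite gt0_muley// lte_fin.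
Qed.

Hypothesis payoff_L2 : (sq_norm (fun w => k N (X N w)) < +oo)%E.

(** The error of the strategy that never trades, with capital zero, is the
    value process itself; the recursion thus carries square-integrability from
    the payoff back to all earlier values. *)
Let noTrade : nat -> T -> R := fun _ _ => 0.

Lemma noTrade_error n : hedge_error n 0 noTrade = fun w => k n (X n w).
Proof.
apply/funext => w; rewrite /hedge_error subr0 /gain big1 ?subr0// => i _.
by rewrite mul0r.
Qed.

Lemma noTrade_predictable : predictable N F noTrade.
Proof. by move=> n nN; exact: measurable_cst. Qed.

Lemma value_process_L2 n : (n <= N)%N -> (sq_norm (fun w => k n (X n w)) < +oo)%E.
Proof.
move=> nN; rewrite -(subKn nN).
elim: (N - n)%N (leq_subr n N) => [|j IH] jN; first by rewrite subn0.
have jN' : (0 < N - j <= N)%N by lia.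
rewrite -noTrade_error.
have := IH (ltnW jN); rewrite -noTrade_error => /(sq_norm_ltyP jN' noTrade_predictable).
by case; rewrite -subnS.
Qed.

Lemma resid_lty n : (0 < n <= N)%N -> (\int[P]_w (resid n w)%:E < +oo)%E.
Proof.
move=> nN; have nN' : (n <= N)%N by lia.
have := value_process_L2 nN'; rewrite -noTrade_error.
by move=> /(sq_norm_ltyP nN noTrade_predictable)[].
Qed.

Lemma hedge_error0 c theta :
  sq_norm (hedge_error 0 c theta) = ((k 0%N 0 - c) ^+ 2)%:E.
Proof.
rewrite /sq_norm (_ : (fun w => _) = cst ((k 0%N 0 - c) ^+ 2)%:E).
  by rewrite integral_cst// [X in (_ * X)%E]probability_setT mule1.
by apply/funext => w /=; rewrite /hedge_error gain0 subr0 X0.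
Qed.

(** The strategy has to be built together with its gains, which it feeds back. *)
Definition opt_position n w (G : R) : R :=
  (chi n.+1 (X n w) + a / b * (k n (X n w) - k 0%N 0 - G)) / S n w.

Fixpoint opt_gain n w : R :=
  if n is j.+1 then opt_gain j w + opt_position j w (opt_gain j w) * incr S n w
  else 0.

Definition opt_strategy n w : R := opt_position n.-1 w (opt_gain n.-1 w).

Lemma gain_opt_strategy n w : gain S opt_strategy n w = opt_gain n w.
Proof. by elim: n => [|n IH]; rewrite ?gain0// gainS//= IH. Qed.

Lemma opt_strategy_dev n w : (0 < n <= N)%N ->
  hedge_dev n (k 0%N 0) opt_strategy w = 0.
Proof.
case: n => // n _; rewrite /hedge_dev /hedge_error gain_opt_strategy /=.
rewrite /opt_strategy /opt_position /= divfK; first by ring.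
by rewrite gt_eqF// price_gt0.
Qed.

Lemma opt_strategy_predictable : predictable N F opt_strategy.
Proof.
have mpos n : (n < N)%N -> measurable_wrt (F n) (opt_gain n) ->
    measurable_wrt (F n) (fun w => opt_position n w (opt_gain n w)).
  move=> nN mG; have mX := X_adapted (ltnW nN).
  rewrite /measurable_wrt (_ : (fun _ => _) = fun w =>
    (chi n.+1 (X n w) + a / b * (k n (X n w) - k 0%N 0 - opt_gain n w)) *
    (S0^-1 * expR (- X n w))); last first.
    by apply/funext => w; rewrite /opt_position /price invfM expRN.
  apply: measurable_funM.
    apply: measurable_funD.
      by apply: (measurableT_comp (chi_meas (n := n.+1) nN)).
    apply: measurable_funM => //; apply: measurable_funB => //.
    apply: measurable_funB => //.
    by apply: (measurableT_comp (k_meas (ltnW nN))).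
  apply: measurable_funM => //.
  by apply: (measurableT_comp (@measurable_expR R)); exact: measurableT_comp.
have mgain n : (n <= N)%N -> measurable_wrt (F n) (opt_gain n).
  elim: n => [|n IH] nN; first exact: measurable_cst.
  have mono (Z : T -> R) : measurable_wrt (F n) Z -> measurable_wrt (F n.+1) Z.
    by move=> mZ; exact: (measurable_wrt_mono (leqnSn n) nN mZ).
  have mGn := IH (ltnW nN).
  apply: measurable_funD; first exact: mono.
  apply: measurable_funM; first by apply: mono; exact: mpos.
  apply: measurable_funB; first exact: measurable_price.
  by apply: mono; apply: measurable_price; exact: ltnW.
case=> // n nN; apply: mpos => //; apply: mgain; exact: ltnW.
Qed.

Section optimum.
Variable phi : nat -> T -> R.
Hypothesis phi_pred : predictable N F phi.
Local Notation c0 := (k 0%N 0).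
Hypothesis phi_dev : forall n w, (0 < n <= N)%N -> hedge_dev n c0 phi w = 0.

Lemma optimal_error_step n : (0 < n <= N)%N ->
  (sq_norm (hedge_error n c0 phi) =
   ((b - a ^+ 2) / b)%:E * sq_norm (hedge_error n.-1 c0 phi) +
   \int[P]_w (resid n w)%:E)%E.
Proof.
move=> nN; rewrite hedge_error_step//.
rewrite [sq_norm (hedge_dev _ _ _)](_ : _ = 0%E) ?mule0 ?add0e//.
by rewrite /sq_norm integral0_eq// => w _; rewrite phi_dev// expr0n.
Qed.

Lemma optimal_error_lty n : (n <= N)%N -> (sq_norm (hedge_error n c0 phi) < +oo)%E.
Proof.
elim: n => [|n IH] nN; first by rewrite hedge_error0 ltry.
rewrite optimal_error_step// lte_add_pinfty//; last exact: resid_lty.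
rewrite lte_mul_pinfty//=; last exact/IH/ltnW.
by rewrite lee_fin divr_ge0// ltW// b_gt0.
Qed.

(** Induction on the recursion: the optimal strategy starts with error zero and
    pays only the unavoidable residuals, while any other one starts with a
    nonnegative error and in addition pays for its deviations. *)
Lemma optimal_error_le n c theta : (n <= N)%N -> predictable N F theta ->
  (sq_norm (hedge_error n c0 phi) <= sq_norm (hedge_error n c theta))%E.
Proof.
move=> + ptheta; elim: n => [|n IH] nN.
  by rewrite !hedge_error0 subrr expr0n lee_fin sqr_ge0.
rewrite optimal_error_step// (hedge_error_step (n := n.+1) c nN ptheta).
apply: leeD2r; rewrite -[leLHS]add0e; apply: leeD.
  by rewrite mule_ge0 ?sq_norm_ge0// lee_fin ltW// b_gt0.
rewrite lee_wpmul2l ?IH//; last exact: ltnW.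
by rewrite lee_fin divr_ge0// ltW// b_gt0.
Qed.

Lemma hedge_error_L2 n : (n <= N)%N -> hedge_error n c0 phi \in Lfun P 2%:E.
Proof.
move=> nN; apply/Lfun2P; split; last exact: optimal_error_lty.
by apply: (measurable_wrtT nN); exact: measurable_error.
Qed.

Lemma optimal_admissible : admissible P N F S phi.
Proof.
split=> // n nN; have nN' : (n <= N)%N by lia.
rewrite (_ : gain _ _ _ = fun w => k n (X n w) - c0 - hedge_error n c0 phi w).
  apply: Lfun2B; last exact: hedge_error_L2.
  apply: Lfun2B; last exact: Lfun_cst.
  apply/Lfun2P; split; last exact: value_process_L2.
  apply: (measurableT_comp (k_meas nN')).
  by apply: (measurable_wrtT nN'); exact: X_adapted.
by apply/funext => w; rewrite /hedge_error; ring.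
Qed.

Lemma ae_eq0_sq (Z : T -> R) : measurable_fun setT Z -> sq_norm Z = 0%E ->
  {ae P, forall w, Z w = 0}.
Proof.
move=> mZ Z0.
have mZ2 : measurable_fun setT (fun w => (Z w ^+ 2)%:E).
  by apply/measurable_EFinP; exact: measurable_funX.
have /ae_eq_integral_abs : (\int[P]_(w in setT) `|(Z w ^+ 2)%:E| = 0)%E.
  by under eq_integral do rewrite /= ger0_norm ?sqr_ge0//.
move=> /(_ measurableT mZ2); apply: filterS => w /(_ I) [].
by move=> /eqP; rewrite sqrf_eq0 => /eqP.
Qed.

(** If a strategy does no worse at the horizon, then no slack is left at any
    earlier step either, down to time 0 where it identifies the capital. *)
Lemma optimal_dev n c theta : (n <= N)%N -> predictable N F theta ->
  (sq_norm (hedge_error n c theta) <= sq_norm (hedge_error n c0 phi))%E ->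
  c = c0 /\ forall j, (0 < j <= n)%N -> sq_norm (hedge_dev j c theta) = 0%E.
Proof.
move=> + ptheta; elim: n => [|n IH] nN.
  rewrite !hedge_error0 subrr expr0n lee_fin => h; split; last by case.
  have : (c0 - c) ^+ 2 == 0 by rewrite eq_le h sqr_ge0.
  by rewrite sqrf_eq0 subr_eq0 => /eqP.
rewrite optimal_error_step// (hedge_error_step (n := n.+1) c nN ptheta) => h.
have rho0 : 0 < (b - a ^+ 2) / b by rewrite divr_gt0// b_gt0.
have fE : sq_norm (hedge_error n c0 phi) \is a fin_num.
  by rewrite ge0_fin_numE ?sq_norm_ge0// optimal_error_lty// ltnW.
have fL : (\int[P]_w (resid n.+1 w)%:E)%E \is a fin_num.
  rewrite ge0_fin_numE ?resid_lty//.
  by apply: integral_ge0 => w _; rewrite lee_fin resid_ge0.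
have [d0 e0] := ereal_squeeze b_gt0 rho0 (sq_norm_ge0 _) (sq_norm_ge0 _)
  (optimal_error_le c (ltnW nN) ptheta) fE fL h.
have [cc0 dj] := IH (ltnW nN) e0; split=> // j.
by rewrite [(j <= _)%N]leq_eqVlt ltnS => /andP[j0 /predU1P[->//|jn]]; apply: dj; rewrite j0.
Qed.

Lemma optimal_unique c theta : predictable N F theta ->
  (sq_norm (hedge_error N c theta) <= sq_norm (hedge_error N c0 phi))%E ->
  c = c0 /\
  {ae P, forall w, forall n, (0 < n <= N)%N -> theta n w = phi n w}.
Proof.
move=> ptheta /(optimal_dev (leqnn N) ptheta)[cc0 dev0]; split=> //.
have : {ae P, forall w, forall n, (0 < n <= N)%N -> hedge_dev n c0 theta w = 0}.
  apply: ae_foralln => n; have [nN|nN] := boolP (0 < n <= N)%N; last first.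
    by apply: nearW => w.
  have n1N : (n.-1 <= N)%N by lia.
  have md : measurable_fun setT (hedge_dev n c0 theta).
    by apply: (measurable_wrtT n1N); exact: measurable_dev.
  have d0 := dev0 _ nN; rewrite cc0 in d0.
  by apply: filterS (ae_eq0_sq md d0) => w ->.
apply: filterS => w dw.
suff gE n : (n <= N)%N -> gain S theta n w = gain S phi n w /\
    forall j, (0 < j <= n)%N -> theta j w = phi j w by exact: (gE _ (leqnn N)).2.
elim: n => [|n IH] nN; first by rewrite !gain0; split=> // -[].
have [gn thn] := IH (ltnW nN).
have thE : theta n.+1 w = phi n.+1 w.
  have := etrans (dw n.+1 nN) (esym (phi_dev w (n := n.+1) nN)).
  rewrite /hedge_dev /hedge_error /=.
  rewrite gn => h; have := addIr _ (addIr _ h).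
  by apply: mulIf; rewrite gt_eqF// price_gt0.
split; first by rewrite (gainS theta)// (gainS phi)//= gn thE.
move=> j; rewrite [(j <= _)%N]leq_eqVlt ltnS => /andP[j0 /predU1P[->//|jn]].
by apply: thn; rewrite j0.
Qed.

End optimum.

Lemma quadratic_errorE H c theta : (forall w, H w = k N (X N w)) ->
  quadratic_error P N S H c theta = sq_norm (hedge_error N c theta).
Proof.
move=> HE; rewrite /quadratic_error unlock; apply: eq_integral => w _.
by rewrite /hedge_error HE; congr EFin; ring.
Qed.

Lemma opt_strategy_variance_optimal H : (forall w, H w = k N (X N w)) ->
  variance_optimal P N F S H (k 0%N 0) opt_strategy.
Proof.
move=> HE; have pphi := opt_strategy_predictable; have dphi := opt_strategy_dev.
split=> [|c theta [ptheta _]]; first exact: optimal_admissible.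
by rewrite !(quadratic_errorE _ _ HE); exact: optimal_error_le.
Qed.

Lemma variance_optimal_unique H V0 phi : (forall w, H w = k N (X N w)) ->
  variance_optimal P N F S H V0 phi ->
  V0 = k 0%N 0 /\
  {ae P, forall w, forall n, (0 < n <= N)%N -> phi n w = opt_strategy n w}.
Proof.
move=> HE [[pphi _] /(_ (k 0%N 0) opt_strategy)].
have [aopt _] := opt_strategy_variance_optimal HE.
rewrite !(quadratic_errorE _ _ HE) => /(_ aopt) le_phi.
exact: (optimal_unique opt_strategy_predictable opt_strategy_dev).
Qed.

End error.

(** * Integrals depending on a parameter and Fubini for charges *)

Section fubini.
Context (R : realType) d1 d2 (Z : measurableType d1) (E : measurableType d2).

(** Whatever the kernel, the real integral is the [fine] part of a difference of
    two extended integrals of nonnegative functions, both measurable in the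
    parameter. *)
Lemma measurable_Rintegral_param (mu : {sigma_finite_measure set E -> \bar R})
    (K : Z * E -> R) :
  measurable_fun setT K -> measurable_fun setT (fun z => \int[mu]_y K (z, y)).
Proof.
move=> mK; have mKE : measurable_fun setT (EFin \o K) by exact/measurable_EFinP.
have mp := measurable_fun_fubini_tonelli_F (m2 := mu) _ (measurable_funepos mKE)
  (funepos_ge0 _).
have mn := measurable_fun_fubini_tonelli_F (m2 := mu) _ (measurable_funeneg mKE)
  (funeneg_ge0 _).
rewrite (_ : (fun _ => _) =
  fine \o (fubini_F mu (EFin \o K)^\+ \- fubini_F mu (EFin \o K)^\-)%E).
  by apply: measurableT_comp => //; exact: emeasurable_funB.
apply/funext => z; rewrite /Rintegral /= integralE.
by rewrite /fubini_F; congr (fine (_ - _)); apply: eq_integral => y _; rewrite ?funeposE ?funenegE.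
Qed. 

Lemma measurable_Rintegral_param_in (mu : {sigma_finite_measure set E -> \bar R})
    (D : set E) (K : Z * E -> R) : measurable D ->
  measurable_fun setT K -> measurable_fun setT (fun z => \int[mu]_(y in D) K (z, y)).
Proof.
move=> mD mK.
have mK' : measurable_fun setT (fun zy : Z * E => K zy * \1_D zy.2).
  apply: measurable_funM => //.
  by apply: (measurableT_comp (f := (\1_D : E -> R)) _ measurable_snd); exact: measurable_indic.
rewrite (_ : (fun _ => _) = fun z => \int[mu]_y (K (z, y) * \1_D y)).
  exact: (measurable_Rintegral_param _ mK').
apply/funext => z; rewrite Rintegral_mkcond; congr Rintegral.
by apply/funext => y; rewrite patchE indicE; case: ifP; rewrite ?mulr1 ?mulr0.
Qed.

Variables (nu : {finite_measure set Z -> \bar R})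
  (mu : {finite_measure set E -> \bar R}) (D : set Z) (mD : measurable D).
Variables (K : Z * E -> R) (B : E -> R).
Hypothesis mK : measurable_fun setT K.
Hypothesis KB : forall z y, D z -> `|K (z, y)| <= B y.
Hypothesis iB : mu.-integrable setT (EFin \o B).

(* The kernel cut off outside [D], to work on the whole product space. *)
Let KD (zy : Z * E) : \bar R := (K zy * \1_D zy.1)%:E.

Let mKD : measurable_fun setT KD.
Proof.
apply/measurable_EFinP; apply: measurable_funM => //.
by apply: (measurableT_comp (f := (\1_D : Z -> R)) _ measurable_fst); exact: measurable_indic.
Qed.

Let KDB z y : (`|KD (z, y)| <= (`|B y|)%:E)%E.
Proof.
rewrite /KD /= lee_fin indicE; case: (boolP (z \in D)) => [|_].
  by rewrite inE mulr1 => zD; rewrite (le_trans (KB y zD))// ler_norm.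
by rewrite mulr0 normr0.
Qed.

Let iKD : (nu \x mu)%E.-integrable setT KD.
Proof.
apply/integrable12ltyP => //.
apply: (@le_lt_trans _ _ (\int[nu]_z (\int[mu]_y (`|B y|)%:E))%E).
  apply: ge0_le_integral => //.
  - by move=> z _; exact: integral_ge0.
  - exact: (measurable_fun_fubini_tonelli_F (fun zy => `|KD zy|)%E (measurableT_comp _ mKD)).
  - move=> z _; apply: ge0_le_integral => //.
    + apply: (measurableT_comp (f := abse)) => //.
      exact: (measurableT_comp mKD (pair1_measurable z)).
    + apply/measurable_EFinP/measurableT_comp => //.
      by apply/measurable_EFinP; exact: (measurable_int mu).
rewrite integral_cst// lte_mul_pinfty//; first exact: integral_ge0.
- apply: integrable_fin_num => //; exact: integrable_norm.
- by rewrite -ge0_fin_numE// fin_num_measure.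
Qed.

Let intK z : D z -> mu.-integrable setT (EFin \o (fun y => K (z, y))).
Proof.
move=> zD; apply: le_integrable iB => //.
  by apply/measurable_EFinP/(measurableT_comp mK)/pair1_measurable.
by move=> y _; rewrite lee_fin (le_trans (KB y zD))// ler_norm.
Qed.

Lemma Rintegral_Fubini :
  \int[nu]_(z in D) (\int[mu]_y K (z, y)) =
    \int[mu]_y (\int[nu]_(z in D) K (z, y)) /\
  mu.-integrable setT (fun y => (\int[nu]_(z in D) K (z, y))%:E).
Proof.
have fKD y : nu.-integrable setT (fun z => KD (z, y)).
  apply: (@le_integrable _ _ _ nu _ measurableT _ (cst (`|B y|%:E))).
  - exact: (measurableT_comp mKD (pair2_measurable y)).
  - by move=> z _; rewrite /= normr_id; exact: KDB.
  - exact: finite_measure_integrable_cst.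
have KDy y : (\int[nu]_(z in D) K (z, y))%:E = (\int[nu]_z KD (z, y))%E.
  rewrite -[RHS]fineK; last exact: integrable_fin_num.
  congr EFin; rewrite Rintegral_mkcond /Rintegral; congr fine.
  apply: eq_integral => z _.
  by rewrite /KD patchE indicE; case: ifP; rewrite ?mulr1 ?mulr0.
have KDz z : D z -> (\int[mu]_y K (z, y))%:E = (\int[mu]_y KD (z, y))%E.
  move=> zD; rewrite /Rintegral fineK; last first.
    by apply: integrable_fin_num => //; exact: intK.
  by apply: eq_integral => y _; rewrite /KD indicE mem_set// mulr1.
split; last first.
  have mG := measurable_fubini_G iKD.
  apply: (@le_integrable _ _ _ mu _ measurableT _
    (fun y => ((fine (nu setT))%:E * (EFin \o (Num.norm \o B)) y)%E)).
  - by apply: eq_measurable_fun mG => y _; rewrite KDy.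
  - move=> y _; rewrite KDy; apply: (le_trans (le_abse_integral _ _ _)) => //.
      exact: (measurableT_comp mKD (pair2_measurable y)).
    rewrite gee0_abs; last by apply: mule_ge0; rewrite lee_fin ?fine_ge0 ?normr_ge0.
    apply: (@le_trans _ _ (\int[nu]_z (`|B y|%:E))%E).
      apply: ge0_le_integral => //.
      apply: (measurableT_comp (f := abse)) => //.
      exact: (measurableT_comp mKD (pair2_measurable y)).
    by rewrite integral_cst// muleC fineK// fin_num_measure.
  - by apply: integrableZl => //; exact: integrable_norm.
rewrite /Rintegral; congr fine.
transitivity (\int[nu]_z \int[mu]_y KD (z, y))%E.
  rewrite integral_mkcond; apply: eq_integral => z _; rewrite patchE.
  case: ifPn => [/set_mem zD|zD]; first by rewrite -KDz.
  rewrite integral0_eq// => y _.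
  by rewrite /KD indicE (negbTE zD) mulr0.
rewrite (Fubini (m1 := nu) (m2 := mu) iKD).
by apply: eq_integral => y _; rewrite -KDy.
Qed.

End fubini.

Section charges.
Context (R : realType) d1 (Z : measurableType d1).
Variables (D : set Z) (mD : measurable D).
Variable nu : {charge set Z -> \bar R}.

Definition bdd_on (u : Z -> R) :=
  measurable_fun setT u /\ exists M, forall z, D z -> `|u z| <= M.

Lemma bdd_on_integrable (m : {finite_measure set Z -> \bar R}) u : bdd_on u ->
  m.-integrable D (EFin \o u).
Proof.
move=> [mu_ [M uM]]; apply: (@le_integrable _ _ _ m _ mD _ (cst (M%:E))).
- by apply/measurable_EFinP; exact: measurable_funTS.
- by move=> z zD /=; rewrite lee_fin (le_trans (uM z zD))// ler_norm.
- exact: finite_measure_integrable_cst.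
Qed.

Lemma charge_integralZ (c : R) u : bdd_on u ->
  charge_integral nu D (fun z => c * u z) = c * charge_integral nu D u.
Proof.
by move=> bu; rewrite /charge_integral !RintegralZl ?mulrBr//; exact: bdd_on_integrable.
Qed.

Lemma eq_charge_integral u v : (forall z, D z -> u z = v z) ->
  charge_integral nu D u = charge_integral nu D v.
Proof.
move=> uv; rewrite /charge_integral.
by congr (_ - _); apply: eq_Rintegral => z /set_mem; exact: uv.
Qed.

Lemma charge_integral_le : exists C, forall u M, bdd_on u ->
  (forall z, D z -> `|u z| <= M) -> `|charge_integral nu D u| <= C * M.
Proof.
have key (m : {finite_measure set Z -> \bar R}) u M : bdd_on u ->
    (forall z, D z -> `|u z| <= M) -> `|\int[m]_(z in D) u z| <= fine (m D) * M.
  move=> bu uM; have iu := bdd_on_integrable m bu.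
  rewrite mulrC -Rintegral_cst//.
  apply: (le_trans (le_normr_Rintegral mD iu)).
  apply: le_Rintegral => //; first exact: integrable_norm.
  exact: finite_measure_integrable_cst.
exists (fine (jordan_pos (hahn_posneg nu) D) +
        fine (jordan_neg (hahn_posneg nu) D)).
move=> u M bu uM; rewrite mulrDl /charge_integral.
by apply: (le_trans (ler_normB _ _)); apply: lerD; exact: key.
Qed.

Context d2 (E : measurableType d2) (mu : {finite_measure set E -> \bar R}).

Lemma measurable_charge_integral (K : Z * E -> R) : measurable_fun setT K ->
  measurable_fun setT (fun y => charge_integral nu D (fun z => K (z, y))).
Proof.
move=> mK.
have mK' : measurable_fun setT (fun yz : E * Z => K (yz.2, yz.1)).
  apply: (measurableT_comp mK).
  by apply: measurable_fun_pair; [exact: measurable_snd|exact: measurable_fst].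
apply: measurable_funB.
  exact: (measurable_Rintegral_param_in (jordan_pos (hahn_posneg nu)) mD mK').
exact: (measurable_Rintegral_param_in (jordan_neg (hahn_posneg nu)) mD mK').
Qed.

Lemma charge_Fubini (K : Z * E -> R) (B : E -> R) :
  measurable_fun setT K ->
  (forall z y, D z -> `|K (z, y)| <= B y) ->
  mu.-integrable setT (EFin \o B) ->
  charge_integral nu D (fun z => \int[mu]_y K (z, y)) =
    \int[mu]_y charge_integral nu D (fun z => K (z, y)) /\
  mu.-integrable setT (fun y => (charge_integral nu D (fun z => K (z, y)))%:E).
Proof.
move=> mK KB iB.
have [e1 i1] := Rintegral_Fubini (jordan_pos (hahn_posneg nu)) mD mK KB iB.
have [e2 i2] := Rintegral_Fubini (jordan_neg (hahn_posneg nu)) mD mK KB iB.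
split; first by rewrite /charge_integral e1 e2 RintegralB.
by have := integrableB measurableT i1 i2; apply: eq_integrable.
Qed.

End charges.

(** * The complex exponential on the strip *)

Section complex_facts.
Variable R : realType.
Implicit Types x y z : R[i].

Lemma complex_ReM x y : complex.Re (x * y) =
  complex.Re x * complex.Re y - complex.Im x * complex.Im y.
Proof. by case: x; case: y. Qed.

Lemma complex_ImM x y : complex.Im (x * y) =
  complex.Re x * complex.Im y + complex.Im x * complex.Re y.
Proof. by case: x => ? ?; case: y => ? ? /=. Qed.

Lemma complexP x y : complex.Re x = complex.Re y -> complex.Im x = complex.Im y ->
  x = y.
Proof. by case: x => ? ?; case: y => ? ? /= -> ->. Qed.

Lemma Re_cexp z : complex.Re (cexp z) = expR (complex.Re z) * cos (complex.Im z).
Proof. by rewrite /cexp complex_ReM /= mul0r subr0. Qed.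

Lemma Im_cexp z : complex.Im (cexp z) = expR (complex.Re z) * sin (complex.Im z).
Proof. by rewrite /cexp complex_ImM /= mul0r addr0. Qed.

Lemma cexpD x y : cexp (x + y) = cexp x * cexp y.
Proof.
apply: complexP.
  rewrite Re_cexp [RHS]complex_ReM !Re_cexp !Im_cexp raddfD/= raddfD/= expRD cosD.
  by ring.
rewrite Im_cexp [RHS]complex_ImM !Re_cexp !Im_cexp raddfD/= raddfD/= expRD sinD.
by ring.
Qed.

Lemma cexp_real (t : R) : cexp t%:C = (expR t)%:C.
Proof. by apply: complexP; rewrite ?Re_cexp ?Im_cexp /= ?cos0 ?sin0 ?mulr1 ?mulr0. Qed.

Lemma Re_scale z (t : R) : complex.Re (z * t%:C) = complex.Re z * t.
Proof. by rewrite complex_ReM /= mulr0 subr0. Qed.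

Lemma Im_scale z (t : R) : complex.Im (z * t%:C) = complex.Im z * t.
Proof. by rewrite complex_ImM /= mulr0 add0r. Qed.

Lemma measurable_Re : measurable_fun setT (@complex.Re R).
Proof.
move=> _ B mB; rewrite setTI.
exists (B `*` setT); first exact: measurableX.
by rewrite setTI; apply/seteqP; split=> // -[x y] //= [].
Qed.

Lemma measurable_Im : measurable_fun setT (@complex.Im R).
Proof.
move=> _ B mB; rewrite setTI.
exists (setT `*` B); first exact: measurableX.
by rewrite setTI; apply/seteqP; split=> // -[x y] //= [].
Qed.

Lemma measurable_strip (a b : R) : measurable (strip a b : set R[i]).
Proof.
have -> : strip a b = [set: R[i]] `&` @complex.Re R @^-1` `[a, b].
  apply/seteqP; split => z /=; first by move=> [h1 h2]; rewrite in_itv /= h1 h2.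
  by rewrite in_itv/= => -[_ /andP[]].
exact: measurable_Re.
Qed.

End complex_facts.

Section transform.
Variables (R : realType) (R' R'' : R).
Local Notation D := (strip R' R'').
Let mD : measurable D := measurable_strip R' R''.

Definition cbdd_on (q : R[i] -> R[i]) :=
  bdd_on D (fun z => complex.Re (q z)) /\ bdd_on D (fun z => complex.Im (q z)).

Lemma bdd_onM (u v : R[i] -> R) : bdd_on D u -> bdd_on D v ->
  bdd_on D (fun z => u z * v z).
Proof.
move=> [mu [M uM]] [mv [M' vM]]; split; first exact: measurable_funM.
by exists (M * M') => z zD; rewrite normrM ler_pM ?uM ?vM.
Qed.

Lemma bdd_onD (u v : R[i] -> R) : bdd_on D u -> bdd_on D v ->
  bdd_on D (fun z => u z + v z).
Proof.
move=> [mu [M uM]] [mv [M' vM]]; split; first exact: measurable_funD.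
by exists (M + M') => z zD; rewrite (le_trans (ler_normD _ _))// lerD ?uM ?vM.
Qed.

Lemma bdd_onB (u v : R[i] -> R) : bdd_on D u -> bdd_on D v ->
  bdd_on D (fun z => u z - v z).
Proof.
move=> [mu [M uM]] [mv [M' vM]]; split; first exact: measurable_funB.
by exists (M + M') => z zD; rewrite (le_trans (ler_normB _ _))// lerD ?uM ?vM.
Qed.

Lemma cbdd_onM p q : cbdd_on p -> cbdd_on q -> cbdd_on (fun z => p z * q z).
Proof.
move=> [rp ip] [rq iq]; split.
  rewrite (_ : (fun _ => _) = fun z => complex.Re (p z) * complex.Re (q z) -
    complex.Im (p z) * complex.Im (q z)); first by apply: bdd_onB; exact: bdd_onM.
  by apply/funext => z; rewrite complex_ReM.
rewrite (_ : (fun _ => _) = fun z => complex.Re (p z) * complex.Im (q z) +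
  complex.Im (p z) * complex.Re (q z)); first by apply: bdd_onD; exact: bdd_onM.
by apply/funext => z; rewrite complex_ImM.
Qed.

Lemma cbdd_on_cst (c : R[i]) : cbdd_on (fun=> c).
Proof.
by split; split => //; [exists (`|complex.Re c|)|exists (`|complex.Im c|)].
Qed.

Lemma cbdd_onX q n : cbdd_on q -> cbdd_on (fun z => q z ^+ n).
Proof.
move=> bq; elim: n => [|n IH].
  by under eq_fun do rewrite expr0; exact: cbdd_on_cst.
by under eq_fun do rewrite exprS; exact: cbdd_onM.
Qed.

(** Dominates [s `^ z], for [s = expR t], on the whole strip. *)
Definition env (t : R) : R := expR (R' * t) + expR (R'' * t).

Lemma expR_env z t : D z -> expR (complex.Re z * t) <= env t.
Proof.
move=> [h1 h2]; rewrite /env; have [t0|t0] := leP 0 t.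
  by rewrite (@le_trans _ _ (expR (R'' * t)))// ?ler_expR ?ler_wpM2r// lerDr expR_ge0.
rewrite (@le_trans _ _ (expR (R' * t)))// ?lerDl ?expR_ge0//.
by rewrite ler_expR ler_wnM2r// ltW.
Qed.

(** The integrand [s `^ z * q z] in terms of the log-price [t]; additivity in [t]
    is what turns a price move into a convolution. *)
Definition wave (q : R[i] -> R[i]) (z : R[i]) (t : R) : R[i] :=
  cexp (z * t%:C) * q z.

Lemma waveD q z s t : wave q z (s + t) = cexp (z * s%:C) * wave q z t.
Proof. by rewrite /wave raddfD/= mulrDr cexpD mulrA. Qed.

Lemma measurable_wave q :
  measurable_fun setT (fun z => complex.Re (q z)) ->
  measurable_fun setT (fun z => complex.Im (q z)) ->
  measurable_fun setT (fun zt : R[i] * R => complex.Re (wave q zt.1 zt.2)) /\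
  measurable_fun setT (fun zt : R[i] * R => complex.Im (wave q zt.1 zt.2)).
Proof.
move=> mr mi.
have mre : measurable_fun setT (fun zt : R[i] * R => complex.Re zt.1 * zt.2).
  by apply: measurable_funM => //; exact: (measurableT_comp (@measurable_Re R)).
have mim : measurable_fun setT (fun zt : R[i] * R => complex.Im zt.1 * zt.2).
  by apply: measurable_funM => //; exact: (measurableT_comp (@measurable_Im R)).
have mexp := measurableT_comp (@measurable_expR R) mre.
have mcos : measurable_fun setT (@cos R).
  by apply: continuous_measurable_fun; exact: continuous_cos.
have msin : measurable_fun setT (@sin R).
  by apply: continuous_measurable_fun; exact: continuous_sin.
have mcos' := measurable_funM mexp (measurableT_comp mcos mim).
have msin' := measurable_funM mexp (measurableT_comp msin mim).
have mr' : measurable_fun setT (fun zt : R[i] * R => complex.Re (q zt.1)).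
  exact: (measurableT_comp mr).
have mi' : measurable_fun setT (fun zt : R[i] * R => complex.Im (q zt.1)).
  exact: (measurableT_comp mi).
split.
  have := measurable_funB (measurable_funM mcos' mr') (measurable_funM msin' mi').
  by apply: eq_measurable_fun => -[z t] _ /=;
    rewrite /wave complex_ReM Re_cexp Im_cexp Re_scale Im_scale.
have := measurable_funD (measurable_funM mcos' mi') (measurable_funM msin' mr').
by apply: eq_measurable_fun => -[z t] _ /=;
  rewrite /wave complex_ImM Re_cexp Im_cexp Re_scale Im_scale.
Qed.

Lemma cexp_le z t : D z -> `|complex.Re (cexp (z * t%:C))| <= env t /\
  `|complex.Im (cexp (z * t%:C))| <= env t.
Proof.
move=> zD; rewrite Re_cexp Im_cexp Re_scale Im_scale !normrM.
rewrite (ger0_norm (expR_ge0 _)); split.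
  rewrite (le_trans _ (expR_env t zD))// ler_piMr ?expR_ge0//.
  by rewrite ler_norml cos_geN1 cos_le1.
rewrite (le_trans _ (expR_env t zD))// ler_piMr ?expR_ge0//.
by rewrite ler_norml sin_geN1 sin_le1.
Qed.

Lemma wave_le q : cbdd_on q -> exists M, forall z t, D z ->
  `|complex.Re (wave q z t)| <= M * env t /\ `|complex.Im (wave q z t)| <= M * env t.
Proof.
move=> [[_ [M1 h1]] [_ [M2 h2]]]; exists (`|M1| + `|M2|).
move=> z t zD; have [b1 b2] := cexp_le t zD.
have {}h1 := le_trans (h1 z zD) (ler_norm _).
have {}h2 := le_trans (h2 z zD) (ler_norm _).
rewrite /wave [_ * env t]mulrC mulrDr; split.
  rewrite [X in `|X|]complex_ReM (le_trans (ler_normB _ _))//.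
  by rewrite lerD// normrM ler_pM.
rewrite [X in `|X|]complex_ImM (le_trans (ler_normD _ _))//.
by rewrite addrC lerD// normrM ler_pM.
Qed.

End transform.

(** * Integrals over the strip and expectations *)

Section transform_step.
Variables (R : realType) (R' R'' : R).
Local Notation D := (strip R' R'').
Let mD : measurable D := measurable_strip R' R''.
Local Notation env := (env R' R'').
Variable mu : probability R R.
Hypothesis expR'_L2 : (fun y => expR (R' * y)) \in Lfun mu 2%:E.
Hypothesis expR''_L2 : (fun y => expR (R'' * y)) \in Lfun mu 2%:E.
Variable Pi : {charge set R[i] -> \bar R[i]}.

Lemma env_L2 x : (fun y => env (x + y)) \in Lfun mu 2%:E.
Proof.
rewrite (_ : (fun _ => _) = fun y => expR (R' * x) * expR (R' * y) +
  expR (R'' * x) * expR (R'' * y)); first by apply: Lfun2D; exact: Lfun2Z.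
by apply/funext => y; rewrite /env !mulrDr !expRD.
Qed.

Lemma env_weight (w : R -> R) x c : w \in Lfun mu 2%:E ->
  mu.-integrable setT (EFin \o (fun y => c * env (x + y) * `|w y|)).
Proof.
move=> w2; apply: Lfun2_mul; first exact/Lfun2Z/env_L2.
have [mw _] := (Lfun2P _ _).1 w2; apply/Lfun2P; split; first exact: measurableT_comp.
have [_] := (Lfun2P _ _).1 w2.
by under eq_integral do rewrite -real_normK ?num_real//.
Qed.

(** The claim is the case [q = 1]; going back in time will only change [q]. *)
Definition strip_integral (q : R[i] -> R[i]) (x : R) : R[i] :=
  complex_charge_integral Pi D (fun z => wave q z x).

(** [E (exp (z Y) * w Y)] for a variable [Y] of law [mu]; the moment function of
    the log-return is the case [w = 1]. *)
Definition moment (w : R -> R) (z : R[i]) : R[i] :=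
  (\int[mu]_y (complex.Re (cexp (z * y%:C)) * w y)) +i*
  (\int[mu]_y (complex.Im (cexp (z * y%:C)) * w y)).

Lemma measurable_cexp :
  measurable_fun setT (fun zt : R[i] * R => complex.Re (cexp (zt.1 * zt.2%:C))) /\
  measurable_fun setT (fun zt : R[i] * R => complex.Im (cexp (zt.1 * zt.2%:C))).
Proof.
have m1 := measurable_cst.
have [mr mi] := @measurable_wave R (fun=> 1) (m1 _ _ _ _ _ _) (m1 _ _ _ _ _ _).
split; [apply: eq_measurable_fun mr|apply: eq_measurable_fun mi] => zt _;
  by rewrite /wave mulr1.
Qed.

Section weight.
Variable w : R -> R.
Hypothesis w2 : w \in Lfun mu 2%:E.
Let mw : measurable_fun setT w. Proof. by have [] := (Lfun2P _ _).1 w2. Qed.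

Lemma moment_integrable z : D z ->
  mu.-integrable setT (EFin \o (fun y => complex.Re (cexp (z * y%:C)) * w y)) /\
  mu.-integrable setT (EFin \o (fun y => complex.Im (cexp (z * y%:C)) * w y)).
Proof.
move=> zD; have [mr mi] := measurable_cexp.
have ie : mu.-integrable setT (EFin \o (fun y => env y * `|w y|)).
  have := env_weight 0 1 w2.
  by apply: eq_integrable => // y _ /=; rewrite mul1r add0r.
split; apply: le_integrable ie => //.
- apply/measurable_EFinP/measurable_funM => //.
  exact: (measurableT_comp mr (pair1_measurable z)).
- move=> y _; rewrite lee_fin !normrM normr_id ler_wpM2r//.
  by rewrite (le_trans (cexp_le y zD).1)// ler_norm.
- apply/measurable_EFinP/measurable_funM => //.
  exact: (measurableT_comp mi (pair1_measurable z)).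
- move=> y _; rewrite lee_fin !normrM normr_id ler_wpM2r//.
  by rewrite (le_trans (cexp_le y zD).2)// ler_norm.
Qed.

Lemma cbdd_moment : cbdd_on R' R'' (moment w).
Proof.
have [mr mi] := measurable_cexp.
have mw' : measurable_fun setT (fun zt : R[i] * R => w zt.2).
  exact: (measurableT_comp mw).
have ie : mu.-integrable setT (EFin \o (fun y => env y * `|w y|)).
  have := env_weight 0 1 w2.
  by apply: eq_integrable => // y _ /=; rewrite mul1r add0r.
split; split.
- exact: (measurable_Rintegral_param _ (measurable_funM mr mw')).
- exists (\int[mu]_y (env y * `|w y|)) => z zD /=.
  have [i1 i2] := moment_integrable zD.
  apply: (le_trans (le_normr_Rintegral measurableT i1)).
  apply: le_Rintegral => //; first exact: integrable_norm.
  by move=> y _; rewrite normrM ler_wpM2r// (cexp_le y zD).1.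
- exact: (measurable_Rintegral_param _ (measurable_funM mi mw')).
- exists (\int[mu]_y (env y * `|w y|)) => z zD /=.
  have [i1 i2] := moment_integrable zD.
  apply: (le_trans (le_normr_Rintegral measurableT i2)).
  apply: le_Rintegral => //; first exact: integrable_norm.
  by move=> y _; rewrite normrM ler_wpM2r// (cexp_le y zD).2.
Qed.

Lemma scale_moment (c z : R[i]) : D z ->
  c * moment w z =
  (\int[mu]_y (complex.Re (c * cexp (z * y%:C)) * w y)) +i*
  (\int[mu]_y (complex.Im (c * cexp (z * y%:C)) * w y)).
Proof.
move=> zD; have [i1 i2] := moment_integrable zD.
rewrite /moment; apply: complexP.
  rewrite [LHS]complex_ReM /=.
  rewrite -RintegralZl// -[X in _ - X]RintegralZl// -RintegralB//; try exact: integrable_mull.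
  congr Rintegral; apply/funext => y.
  by rewrite [complex.Re (_ * cexp _)]complex_ReM Re_cexp Im_cexp; ring.
rewrite [LHS]complex_ImM /= -RintegralZl// -[X in _ + X]RintegralZl// -RintegralD//; try exact: integrable_mull.
congr Rintegral; apply/funext => y.
by rewrite [complex.Im (_ * cexp _)]complex_ImM Re_cexp Im_cexp; ring.
Qed.

Lemma wave_moment q x z : D z ->
  wave (fun z => q z * moment w z) z x =
  (\int[mu]_y (complex.Re (wave q z (x + y)) * w y)) +i*
  (\int[mu]_y (complex.Im (wave q z (x + y)) * w y)).
Proof.
move=> zD; rewrite {1}/wave mulrA scale_moment//.
have eqc y : cexp (z * x%:C) * q z * cexp (z * y%:C) = wave q z (x + y).
  by rewrite waveD /wave; ring.
by congr (_ +i* _); congr Rintegral; apply/funext => y; rewrite eqc.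
Qed.

(** Fubini's theorem, to be used with the real or imaginary part of the complex
    measure for [nu] and the real or imaginary part of a wave for [U]. *)
Lemma charge_integral_weight (nu : {charge set R[i] -> \bar R})
    (U : R[i] -> R -> R) M x :
  measurable_fun setT (fun zt : R[i] * R => U zt.1 zt.2) ->
  (forall z t, D z -> `|U z t| <= M * env t) ->
  charge_integral nu D (fun z => \int[mu]_y (U z (x + y) * w y)) =
    \int[mu]_y (charge_integral nu D (fun z => U z (x + y)) * w y) /\
  mu.-integrable setT
    (EFin \o (fun y => charge_integral nu D (fun z => U z (x + y)) * w y)).
Proof.
move=> mU UM.
have mshift : measurable_fun setT (fun zy : R[i] * R => (zy.1, x + zy.2)).
  by apply: measurable_fun_pair => //; exact: measurable_funD.
have mw' : measurable_fun setT (fun zt : R[i] * R => w zt.2).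
  exact: (measurableT_comp mw).
have UB z y : D z -> `|U z (x + y) * w y| <= M * env (x + y) * `|w y|.
  by move=> zD; rewrite normrM ler_wpM2r// UM.
have bU y : bdd_on D (fun z => U z (x + y)).
  split; first exact: (measurableT_comp mU (pair2_measurable (x + y))).
  by exists (M * env (x + y)) => z zD; exact: UM.
have wU y : charge_integral nu D (fun z => U z (x + y) * w y) =
    charge_integral nu D (fun z => U z (x + y)) * w y.
  rewrite [RHS]mulrC -charge_integralZ//; congr charge_integral.
  by apply/funext => z; exact: mulrC.
have [e i] := charge_Fubini mD nu
  (measurable_funM (measurableT_comp mU mshift) mw') UB (env_weight x M w2).
split; first by rewrite e; congr Rintegral; exact: funext.
by apply: eq_integrable i => // y _ /=; rewrite wU.
Qed.

(** A factor [moment w z] under the integral over the strip amounts to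
    averaging the function at the price after one more period with the
    weight [w]. *)
Lemma strip_integral_moment q x : cbdd_on R' R'' q ->
  strip_integral (fun z => q z * moment w z) x =
  (\int[mu]_y (complex.Re (strip_integral q (x + y)) * w y)) +i*
  (\int[mu]_y (complex.Im (strip_integral q (x + y)) * w y)).
Proof.
move=> bq; have [mr mi] := measurable_wave bq.1.1 bq.2.1.
have [M qM] := wave_le bq.
have [rB iBd] := (fun z t zD => (qM z t zD).1, fun z t zD => (qM z t zD).2).
have keyR nu := charge_integral_weight nu
  (U := fun z t => complex.Re (wave q z t)) x mr rB.
have keyI nu := charge_integral_weight nu
  (U := fun z t => complex.Im (wave q z t)) x mi iBd.
have wR z (zD : D z) : complex.Re (wave (fun z => q z * moment w z) z x) =
    \int[mu]_y (complex.Re (wave q z (x + y)) * w y) by rewrite wave_moment.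
have wI z (zD : D z) : complex.Im (wave (fun z => q z * moment w z) z x) =
    \int[mu]_y (complex.Im (wave q z (x + y)) * w y) by rewrite wave_moment.
have [e1 i1] := keyR (re_charge Pi); have [e2 i2] := keyI (im_charge Pi).
have [e3 i3] := keyI (re_charge Pi); have [e4 i4] := keyR (im_charge Pi).
rewrite {1}/strip_integral /complex_charge_integral.
rewrite (eq_charge_integral (re_charge Pi) wR) e1.
rewrite (eq_charge_integral (im_charge Pi) wI) e2.
rewrite (eq_charge_integral (re_charge Pi) wI) e3.
rewrite (eq_charge_integral (im_charge Pi) wR) e4.
rewrite -RintegralB// -RintegralD//.
by congr (_ +i* _); congr Rintegral; apply/funext => y; rewrite /strip_integral /=; ring.
Qed.

End weight.

Lemma strip_integral_le q : cbdd_on R' R'' q ->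
  exists C, forall x, `|complex.Re (strip_integral q x)| <= C * env x.
Proof.
move=> bq; have [M qM] := wave_le bq; have [mr mi] := measurable_wave bq.1.1 bq.2.1.
have [C hC] := charge_integral_le mD (re_charge Pi).
have [C' hC'] := charge_integral_le mD (im_charge Pi).
exists (C * M + C' * M) => x; rewrite mulrDl -!mulrA.
apply: (le_trans (ler_normB _ _)); apply: lerD.
  apply: hC => [|z zD]; last exact: (qM _ _ zD).1.
  split; first exact: (measurableT_comp mr (pair2_measurable _)).
  by exists (M * env x) => z zD; exact: (qM _ _ zD).1.
apply: hC' => [|z zD]; last exact: (qM _ _ zD).2.
split; first exact: (measurableT_comp mi (pair2_measurable _)).
by exists (M * env x) => z zD; exact: (qM _ _ zD).2.
Qed.

Lemma measurable_strip_integral q : cbdd_on R' R'' q ->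
  measurable_fun setT (fun x => complex.Re (strip_integral q x)).
Proof.
move=> bq; have [mr mi] := measurable_wave bq.1.1 bq.2.1.
apply: measurable_funB.
  exact: (measurable_charge_integral mD (re_charge Pi) mr).
exact: (measurable_charge_integral mD (im_charge Pi) mi).
Qed.

Lemma strip_integral_L2 q x : cbdd_on R' R'' q ->
  (fun y => complex.Re (strip_integral q (x + y))) \in Lfun mu 2%:E.
Proof.
move=> bq; have [C hC] := strip_integral_le bq.
apply: (Lfun2_le _ (Lfun2Z C (env_L2 x))) => //.
apply: (measurableT_comp (measurable_strip_integral bq)).
exact: measurable_funD.
Qed.

Lemma strip_integralZ q (c : R) x : cbdd_on R' R'' q ->
  strip_integral (fun z => c%:C * q z) x = c%:C * strip_integral q x.
Proof.
move=> bq; have [mr mi] := measurable_wave bq.1.1 bq.2.1; have [M qM] := wave_le bq.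
have br : bdd_on D (fun z => complex.Re (wave q z x)).
  split; first exact: (measurableT_comp mr (pair2_measurable _)).
  by exists (M * env x) => z zD; exact: (qM _ _ zD).1.
have bi : bdd_on D (fun z => complex.Im (wave q z x)).
  split; first exact: (measurableT_comp mi (pair2_measurable _)).
  by exists (M * env x) => z zD; exact: (qM _ _ zD).2.
have eR z : complex.Re (wave (fun z => c%:C * q z) z x) = c * complex.Re (wave q z x).
  by rewrite /wave mulrCA [LHS]complex_ReM /= mul0r subr0.
have eI z : complex.Im (wave (fun z => c%:C * q z) z x) = c * complex.Im (wave q z x).
  by rewrite /wave mulrCA [LHS]complex_ImM /= mul0r addr0.
rewrite /strip_integral /complex_charge_integral.
rewrite (funext eR) (funext eI) !charge_integralZ//.
by apply: complexP; rewrite ?[in RHS]complex_ReM ?[in RHS]complex_ImM /=; ring.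
Qed.

Lemma eq_strip_integral p q x : (forall z, D z -> p z = q z) ->
  strip_integral p x = strip_integral q x.
Proof.
move=> pq; rewrite /strip_integral /complex_charge_integral /wave.
by congr (_ +i* _); congr (_ + _); try congr (- _);
  apply: eq_charge_integral => z zD; rewrite pq.
Qed.

End transform_step.

(** * The coefficients g, h and lambda as weighted moments *)

Section coefficients.
Variable R : realType.
Variable mu : probability R R.
Hypothesis exp_L2 : (@expR R) \in Lfun mu 2%:E.
Local Notation Y := (@yield R).
Local Notation a := (mean mu Y).
Local Notation b := (mean mu (fun y => Y y ^+ 2)).
Local Notation V := (b - a ^+ 2).

Lemma yield_L2 : Y \in Lfun mu 2%:E.
Proof. by apply: Lfun2B => //; exact: Lfun_cst. Qed.

Lemma variance_ge0 : 0 <= V.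
Proof.
have [_] := mean_expand a 0 yield_L2 yield_L2.
rewrite (_ : _ - _ + _ = V); last by ring.
by move=> <-; apply: Rintegral_ge0 => y _; exact: sqr_ge0.
Qed.

(** Integrating against these two real weights gives the slope and the intercept
    of the regression on the return, and their moments are [g] and [h]: this
    is why the complex formulas of the theorem compute regressions. *)
Definition hedge_weight (y : R) : R := V^-1 * (Y y - a).
Definition value_weight (y : R) : R := 1 - a * hedge_weight y.

Lemma hedge_weight_L2 : hedge_weight \in Lfun mu 2%:E.
Proof. by apply: Lfun2Z; apply: Lfun2B; [exact: yield_L2|exact: Lfun_cst]. Qed.

Lemma value_weight_L2 : value_weight \in Lfun mu 2%:E.
Proof.
by apply: Lfun2B; [exact: Lfun_cst|apply: Lfun2Z; exact: hedge_weight_L2].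
Qed.

Lemma regr_slope_weight u : u \in Lfun mu 2%:E ->
  regr_slope mu u Y = mean mu (fun y => u y * hedge_weight y).
Proof.
move=> u2; have iu := Lfun2_int u2; have iuy := Lfun2_mul u2 yield_L2.
have iau := integrable_mull a iu.
rewrite /regr_slope /mean -/(mean _ _) mulrC.
rewrite [X in _ * (_ - X)]mulrC -RintegralZl// -RintegralB// -RintegralZl//.
  by congr Rintegral; apply/funext => y; rewrite /hedge_weight /mean; ring.
by have := integrableB measurableT iuy iau; apply: eq_integrable.
Qed.

Lemma regr_icpt_weight u : u \in Lfun mu 2%:E ->
  regr_icpt mu u Y = mean mu (fun y => u y * value_weight y).
Proof.
move=> u2; rewrite /regr_icpt regr_slope_weight//.
have iu := Lfun2_int u2; have iuw := Lfun2_mul u2 hedge_weight_L2.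
rewrite /mean -/(mean _ _) -RintegralZl// -RintegralB//.
  by congr Rintegral; apply/funext => y; rewrite /value_weight /mean; ring.
exact: integrable_mull.
Qed.

Local Notation m := (moment mu (fun=> 1)).

Lemma moment_shift z : m (z + 1) = moment mu (@expR R) z.
Proof.
rewrite /moment; congr (_ +i* _); congr Rintegral; apply/funext => y.
  by rewrite mulr1 mulrDl mul1r cexpD cexp_real Re_scale.
by rewrite mulr1 mulrDl mul1r cexpD cexp_real Im_scale.
Qed.

Lemma moment_real (w : R -> R) (t : R) :
  moment mu w t%:C = (mean mu (fun y => expR (t * y) * w y))%:C.
Proof.
rewrite /moment; congr (_ +i* _).
  congr Rintegral; apply/funext => y.
  by rewrite Re_cexp Re_scale Im_scale /= mul0r cos0 mulr1.
transitivity (\int[mu]_y (0 : R)); last by rewrite Rintegral_cst// mul0r.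
congr Rintegral; apply/funext => y.
by rewrite Im_cexp Re_scale Im_scale /= mul0r sin0 mulr0 mul0r.
Qed.

Lemma Rintegral1 : \int[mu]_y (1 : R) = 1.
Proof.
rewrite Rintegral_cst// mul1r.
by have -> : fine (mu setT) = 1 by rewrite probability_setT.
Qed.

Lemma moment1 : m 1 = (a + 1)%:C.
Proof.
rewrite (_ : 1 = 1%:C)// moment_real; congr (_%:C).
have [i1 ic] := (Lfun2_int yield_L2, Lfun2_int (Lfun_cst mu 1 2)).
rewrite /mean -[X in _ + X](_ : \int[mu]_y (1 : R) = 1).
  rewrite -RintegralD//; congr Rintegral; apply/funext => y.
  by rewrite mul1r mulr1 /yield subrK.
exact: Rintegral1.
Qed.

Lemma moment2 : m 2 = (b + 2 * a + 1)%:C.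
Proof.
rewrite (_ : 2 = 2%:C); last by rewrite rmorph_nat.
rewrite moment_real; congr (_%:C).
have i1 := Lfun2_int yield_L2; have i2 := Lfun2_integrable_sqr yield_L2.
have ic : mu.-integrable setT (EFin \o (fun=> 1 : R)) := Lfun2_int (Lfun_cst mu 1 2).
have i3 := integrable_mull 2 i1; have i4 := integrable_add i2 i3.
rewrite /mean -RintegralZl// -RintegralD// -[X in _ + X](_ : \int[mu]_y (1 : R) = 1).
  rewrite -RintegralD//; congr Rintegral; apply/funext => y.
  have -> : expR (2 * y) = expR y * expR y by rewrite mulr_natl mulr2n expRD.
  by rewrite /yield; ring.
exact: Rintegral1.
Qed.

Hypothesis nondeterministic : m 2 - m 1 ^+ 2 != 0.

Lemma moment_variance : m 2 - m 1 ^+ 2 = V%:C.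
Proof. by rewrite moment1 moment2 -rmorphXn -rmorphB; congr (_%:C); ring. Qed.

Lemma variance_gt0 : 0 < V.
Proof.
rewrite lt_def variance_ge0 andbT; apply: contra nondeterministic.
by rewrite moment_variance => /eqP ->.
Qed.

Lemma hedge_lambdaE : hedge_lambda m = (a / b)%:C.
Proof.
rewrite /hedge_lambda moment1 moment2.
rewrite (_ : (a + 1)%:C - 1 = a%:C); last by rewrite rmorphD addrK.
rewrite (_ : _ - _ + 1 = b%:C); last first.
  rewrite !rmorphD rmorphM rmorph_nat/=; ring.
by rewrite fmorph_div.
Qed.

Variables R' R'' : R.
Hypothesis expR'_L2 : (fun y => expR (R' * y)) \in Lfun mu 2%:E.
Hypothesis expR''_L2 : (fun y => expR (R'' * y)) \in Lfun mu 2%:E.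
Local Notation D := (strip R' R'').

Lemma moment_lin (u v : R -> R) (c d : R) z : D z ->
  u \in Lfun mu 2%:E -> v \in Lfun mu 2%:E ->
  moment mu (fun y => c * u y + d * v y) z =
  c%:C * moment mu u z + d%:C * moment mu v z.
Proof.
move=> zD u2 v2.
have [ur ui] := moment_integrable expR'_L2 expR''_L2 u2 zD.
have [vr vi] := moment_integrable expR'_L2 expR''_L2 v2 zD.
rewrite /moment; apply: complexP.
  rewrite raddfD /= !mul0r !subr0.
  rewrite -!RintegralZl// -RintegralD//; try exact: integrable_mull.
  by congr Rintegral; apply/funext => y; ring.
rewrite raddfD /= !mul0r !addr0.
rewrite -!RintegralZl// -RintegralD//; try exact: integrable_mull.
by congr Rintegral; apply/funext => y; ring.
Qed.

Lemma hedge_gE z : D z -> hedge_g m z = moment mu hedge_weight z.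
Proof.
move=> zD; rewrite /hedge_g moment_variance moment_shift moment1.
rewrite (_ : hedge_weight = fun y => V^-1 * expR y + (- (V^-1 * (a + 1))) * 1).
  rewrite moment_lin//; last exact: Lfun_cst.
  by rewrite rmorphN rmorphM !fmorphV/=; ring.
by apply/funext => y; rewrite /hedge_weight /yield; ring.
Qed.

Lemma hedge_hE z : D z -> hedge_h m z = moment mu value_weight z.
Proof.
move=> zD; rewrite /hedge_h hedge_gE// moment1.
rewrite (_ : value_weight = fun y => 1 * 1 + (- a) * hedge_weight y).
  rewrite moment_lin//; [|exact: Lfun_cst|exact: hedge_weight_L2].
  by rewrite rmorphN rmorphD/= rmorph1; ring.
by apply/funext => y; rewrite /value_weight /mean; ring.
Qed.

End coefficients.

(** * The value functions of the claim *)

Section law.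
Context (R : realType) d (T : measurableType d) (P : probability T R).
Variable Y : {RV P >-> R}.

Lemma Rintegral_distribution (g : R -> R) : measurable_fun setT g ->
  \int[distribution P Y]_y g y = \int[P]_w g (Y w).
Proof.
move=> mg; have mgE : measurable_fun setT (EFin \o g) by exact/measurable_EFinP.
rewrite /Rintegral; congr fine; rewrite integralE [RHS]integralE.
rewrite /distribution; congr (_ - _)%E.
  rewrite ge0_integral_pushforward//; last exact: (measurable_funepos mgE).
  by rewrite preimage_setT; apply: eq_integral => w _; rewrite /= !funeposE.
rewrite ge0_integral_pushforward//; last exact: (measurable_funeneg mgE).
by rewrite preimage_setT; apply: eq_integral => w _; rewrite /= !funenegE.
Qed.

Lemma expR_distribution_L2 (c : R) :
  ('E_P[fun w => (expR (2 * c * Y w))%R] < +oo)%E ->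
  (fun y => expR (c * y)) \in Lfun (distribution P Y) 2%:E.
Proof.
move=> Yc; have me : measurable_fun setT (fun y : R => expR (c * y)).
  by apply: measurableT_comp => //; exact: measurable_funM.
apply/Lfun2P; split=> //; rewrite ge0_integral_pushforward//; last first.
  by apply/measurable_EFinP; exact: measurable_funX.
move: Yc; rewrite unlock; congr (_ < _)%E; apply: eq_integral => w _ /=.
by rewrite expr2 -expRD -mulrA mulr_natl mulr2n.
Qed.

Lemma mgf_distribution : mgf P Y = moment (distribution P Y) (fun=> 1).
Proof.
apply/funext => z; have [mr mi] := measurable_cexp R.
rewrite /mgf /complex_expectation /moment.
under [in RHS]eq_Rintegral do rewrite mulr1.
under [X in _ = _ +i* X]eq_Rintegral do rewrite mulr1.
rewrite !Rintegral_distribution//.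
- exact: (measurableT_comp mi (pair1_measurable z)).
- exact: (measurableT_comp mr (pair1_measurable z)).
Qed.

End law.

Section pricing.
Context (R : realType) (mu : probability R R).
Hypothesis exp_L2 : (@expR R) \in Lfun mu 2%:E.
Local Notation m := (moment mu (fun=> 1)).
Hypothesis nondeterministic : m 2 - m 1 ^+ 2 != 0.
Variables R' R'' : R.
Hypothesis expR'_L2 : (fun y => expR (R' * y)) \in Lfun mu 2%:E.
Hypothesis expR''_L2 : (fun y => expR (R'' * y)) \in Lfun mu 2%:E.
Local Notation D := (strip R' R'').
Variable Pi : {charge set R[i] -> \bar R[i]}.
Variable f : R -> R.
Hypothesis f_integral : forall s, 0 < s ->
  (f s)%:C = complex_charge_integral Pi D (cpow s).

Let q j (z : R[i]) : R[i] := moment mu (value_weight mu) z ^+ j.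
Let qg j (z : R[i]) : R[i] := q j z * moment mu (hedge_weight mu) z.

Let kappa2 := value_weight_L2 exp_L2.
Let gamma2 := hedge_weight_L2 exp_L2.

Let bq j : cbdd_on R' R'' (q j).
Proof. by apply: cbdd_onX; exact: (cbdd_moment expR'_L2 expR''_L2 kappa2). Qed.

Let bqg j : cbdd_on R' R'' (qg j).
Proof.
apply: cbdd_onM; first exact: bq.
exact: (cbdd_moment expR'_L2 expR''_L2 gamma2).
Qed.

(** The value of the claim with [j] periods to go, as a function of the
    log-price. *)
Definition value j x : R := complex.Re (strip_integral R' R'' Pi (q j) x).

Lemma strip_integral_q0 x : strip_integral R' R'' Pi (q 0) x = (f (expR x))%:C.
Proof.
rewrite f_integral ?expR_gt0// /strip_integral; congr complex_charge_integral.
by apply/funext => z; rewrite /wave /q expr0 mulr1 /cpow expRK.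
Qed.

Let strip_integral_qS j x : strip_integral R' R'' Pi (q j.+1) x =
  strip_integral R' R'' Pi (fun z => q j z * moment mu (value_weight mu) z) x.
Proof. by apply: eq_strip_integral => z _; rewrite /q exprSr. Qed.

(** The claim is real, and going back one period means averaging with the real
    weight [value_weight]; hence all value functions are real. *)
Lemma strip_integral_q_real j x : strip_integral R' R'' Pi (q j) x = (value j x)%:C.
Proof.
suff im0 : forall x, complex.Im (strip_integral R' R'' Pi (q j) x) = 0.
  by apply: complexP; rewrite ?im0.
elim: j => [|j IH] {}x; first by rewrite strip_integral_q0.
rewrite strip_integral_qS (strip_integral_moment expR'_L2 expR''_L2 _ kappa2)//.
have -> (u v : R) : complex.Im (u +i* v) = v by [].
transitivity (\int[mu]_y (0 : R)); last by rewrite Rintegral_cst// mul0r.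
by congr Rintegral; apply/funext => y; rewrite IH mul0r.
Qed.

Lemma value0 x : value 0 x = f (expR x).
Proof. by rewrite /value strip_integral_q0. Qed.

Lemma value_L2 j x : (fun y => value j (x + y)) \in Lfun mu 2%:E.
Proof. exact: strip_integral_L2. Qed.

Lemma measurable_value j : measurable_fun setT (value j).
Proof. by apply: measurable_strip_integral. Qed.

Lemma valueS j x :
  value j.+1 x = regr_icpt mu (fun y => value j (x + y)) (@yield R).
Proof.
rewrite regr_icpt_weight//; last exact: value_L2.
by rewrite {1}/value strip_integral_qS (strip_integral_moment expR'_L2 expR''_L2 _ kappa2).
Qed.

Lemma strip_integral_qg j x : strip_integral R' R'' Pi (qg j) x =
  (regr_slope mu (fun y => value j (x + y)) (@yield R))%:C.
Proof.
rewrite regr_slope_weight//; last exact: value_L2.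
rewrite (strip_integral_moment expR'_L2 expR''_L2 _ gamma2)//; congr (_ +i* _).
transitivity (\int[mu]_y (0 : R)); last by rewrite Rintegral_cst// mul0r.
by congr Rintegral; apply/funext => y; rewrite strip_integral_q_real mul0r.
Qed.

Lemma measurable_slope j : measurable_fun setT
  (fun x : R => regr_slope mu (fun y => value j (x + y)) (@yield R)).
Proof.
have := measurable_strip_integral Pi (bqg j); apply: eq_measurable_fun => x _.
by rewrite strip_integral_qg.
Qed.

Lemma hedge_HE N n s : 0 < s -> hedge_H m Pi D N n s = (value (N - n) (ln s))%:C.
Proof.
move=> s0; rewrite -strip_integral_q_real; apply: eq_strip_integral => z zD.
by rewrite (hedge_hE exp_L2 expR'_L2 expR''_L2 zD).
Qed.

Lemma hedge_xiE N n s : 0 < s -> hedge_xi m Pi D N n s =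
  (s^-1 * regr_slope mu (fun y => value (N - n) (ln s + y)) (@yield R))%:C.
Proof.
move=> s0; have realM (u v : R) : (u * v)%:C = u%:C * v%:C by exact: rmorphM.
rewrite realM -strip_integral_qg -strip_integralZ//.
(* The division by the price comes from the exponent [z - 1]. *)
transitivity (strip_integral R' R'' Pi
  (fun z => (s^-1)%:C * (hedge_g m z * hedge_h m z ^+ (N - n))) (ln s)).
  rewrite /strip_integral /hedge_xi; congr complex_charge_integral; apply/funext => z.
  rewrite /wave /cpow mulrBl mul1r -rmorphN cexpD cexp_real expRN lnK//; ring.
apply: eq_strip_integral => z zD.
rewrite (hedge_hE exp_L2 expR'_L2 expR''_L2 zD).
by rewrite (hedge_gE exp_L2 expR'_L2 expR''_L2 zD) /qg /q; ring.
Qed.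

End pricing.

(** * The variance-optimal hedge *)

Theorem theorem2p1 (R : realType) (d : measure_display) (T : measurableType d)
    (P : probability T R) (N : nat) (F : nat -> set (set T))
    (X : nat -> T -> R) (S0 : R)
    (N_gt0 : (0 < N)%N)
    (F_filtration : filtration N F)
    (X_sii : stationary_independent_increments P N F X)
    (S0_gt0 : 0 < S0)
    (X_exp2 : ('E_P[fun w => (expR (2 * X 1%N w))%R] < +oo)%E)
    (S_nondeterministic : mgf P (X 1%N) 2 - mgf P (X 1%N) 1 ^+ 2 != 0)
    (R' R'' : R) (R'_le : R' <= R'')
    (X_expR' : ('E_P[fun w => (expR (2 * R' * X 1%N w))%R] < +oo)%E)
    (X_expR'' : ('E_P[fun w => (expR (2 * R'' * X 1%N w))%R] < +oo)%E)
    (Pi : {charge set R[i] -> \bar R[i]})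
    (Pi_strip : concentrated_on Pi (strip R' R''))
    (f : R -> R)
    (f_integral : forall s, 0 < s ->
      (f s)%:C = complex_charge_integral Pi (strip R' R'') (cpow s))
    (H_L2 : (fun w => f (price S0 X N w)) \in Lfun P 2%:E) :
  let S := price S0 X in
  let H := fun w => f (S N w) in
  let m := mgf P (X 1%N) in
  let Hn := fun n w => hedge_H m Pi (strip R' R'') N n (S n w) in
  let xi := fun n w => hedge_xi m Pi (strip R' R'') N n (S n.-1 w) in
  exists (V0 : R) (phi : nat -> T -> R),
    [/\ forall w, V0%:C = Hn 0%N w,
        forall n w, (0 < n <= N)%N ->
          (phi n w)%:C = xi n w + hedge_lambda m / (S n.-1 w)%:C *
            (Hn n.-1 w - V0%:C - (gain S phi n.-1 w)%:C),
        variance_optimal P N F S H V0 phi &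
        forall (V0' : R) (phi' : nat -> T -> R),
          variance_optimal P N F S H V0' phi' ->
          V0' = V0 /\
          {ae P, forall w, forall n, (0 < n <= N)%N -> phi' n w = phi n w}].
Proof.
move=> S H m Hn xi.
have [X_adapted X0 X_stat X_ind] := X_sii.
have mX1 : measurable_fun setT (X 1%N).
  by apply: (measurable_wrtT F_filtration N_gt0); exact: X_adapted.
pose X1 : {RV P >-> R} := HB.pack (X 1%N) (isMeasurableFun.Build _ _ _ _ _ mX1).
pose mu : probability R R := distribution P X1.
have X_indep n : (0 < n <= N)%N -> forall A B, F n.-1 A -> measurable B ->
    (P (A `&` incr X n @^-1` B) = P A * mu B)%E.
  move=> nN A B FA mB; rewrite X_ind//; congr (_ * _)%E.
  have /= := X_stat n 1%N nN N_gt0 B mB; rewrite /pushforward => ->.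
  rewrite /mu /distribution /pushforward /=; congr (P _).
  by apply/seteqP; split => w /=; rewrite /incr /= X0 subr0.
have exp_L2 : (@expR R) \in Lfun mu 2%:E.
  have := @expR_distribution_L2 R d T P X1 1.
  rewrite mulr1 => /(_ X_exp2).
  by under eq_fun do rewrite mul1r.
have expR'_L2 := expR_distribution_L2 (Y := X1) X_expR'.
have expR''_L2 := expR_distribution_L2 (Y := X1) X_expR''.
have mE : m = moment mu (fun=> 1) by exact: mgf_distribution X1.
have nondet : moment mu (fun=> 1) 2 - moment mu (fun=> 1) 1 ^+ 2 != 0.
  by rewrite -mE.
have var_gt0 := variance_gt0 exp_L2 nondet.
(* Time runs forward in [k], and the initial price is absorbed into the
   argument, so that the value process is [k n (X n)]. *)
pose k n x := value mu R' R'' Pi (N - n) (ln S0 + x).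
have lnS n w : ln (S n w) = ln S0 + X n w.
  by rewrite /S /price lnM ?posrE ?expR_gt0// expRK.
have S_gt0 n w : 0 < S n w by rewrite mulr_gt0// expR_gt0.
have HE w : H w = k N (X N w).
  by rewrite /k subnn (value0 _ f_integral) -lnS lnK// posrE; exact: S_gt0.
have k_meas n : (n <= N)%N -> measurable_fun setT (k n).
  move=> _; apply: measurableT_comp; first exact: measurable_value.
  exact: measurable_funD.
have kD n x : (fun y => k n (x + y)) =
    (fun y => value mu R' R'' Pi (N - n) (ln S0 + x + y)).
  by apply/funext => y; rewrite /k addrA.
have k_L2 n x : (n <= N)%N -> (fun y => k n (x + y)) \in Lfun mu 2%:E.
  by move=> _; rewrite kD; exact: value_L2.
have k_rec n x : (0 < n <= N)%N ->
    k n.-1 x = regr_icpt mu (fun y => k n (x + y)) (@yield R).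
  move=> nN; rewrite kD /k (_ : (N - n.-1)%N = (N - n).+1); last by lia.
  exact: valueS.
have chi_meas n : (0 < n <= N)%N -> measurable_fun setT
    (fun x : R => regr_slope mu (fun y => k n (x + y)) (@yield R)).
  move=> _; under eq_fun do rewrite kD.
  have ms := measurable_slope exp_L2 expR'_L2 expR''_L2 f_integral (N - n).
  by apply: (measurableT_comp ms); exact: measurable_funD.
have H2 : (sq_norm P (fun w => k N (X N w)) < +oo)%E.
  have [_] := (Lfun2P _ _).1 H_L2.
  by congr (_ < _)%E; apply: eq_integral => w _; rewrite -HE.
(* [X 0 = 0], so the initial value is the constant [k 0 0]. *)
exists (k 0%N 0), (opt_strategy X S0 mu k); split.
- move=> w.
  rewrite /Hn mE (hedge_HE exp_L2 expR'_L2 expR''_L2 f_integral)//.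
  by rewrite lnS X0.
- move=> n w nN.
  rewrite /xi /Hn mE !(hedge_HE exp_L2 expR'_L2 expR''_L2 f_integral)//.
  rewrite (hedge_xiE exp_L2 expR'_L2 expR''_L2 f_integral)// lnS.
  rewrite hedge_lambdaE// gain_opt_strategy.
  rewrite -[value _ _ _ _ _ _]/(k n.-1 (X n.-1 w)) -kD.
  rewrite -fmorph_div -!rmorphB -rmorphM -rmorphD; congr (_%:C).
  case: n nN => // n _.
  rewrite /opt_strategy /opt_position /= -/(S n w).
  have Sn := S_gt0 n w; have b0 := b_gt0 var_gt0.
  field; by rewrite !gt_eqF.
- exact: (opt_strategy_variance_optimal F_filtration S0_gt0 X_adapted X0 X_indep
    (yield_L2 exp_L2) var_gt0 k_meas k_L2 k_rec chi_meas H2 HE).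
- move=> V0' phi'.
  exact: (variance_optimal_unique F_filtration S0_gt0 X_adapted X0 X_indep
    (yield_L2 exp_L2) var_gt0 k_meas k_L2 k_rec chi_meas H2 HE).
Qed.
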